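(* Let $K$ and $K'$ be virtual link diagrams, each having an orientable atom, which are equivalent by (generalized) Reidemeister moves. Then there is a finite sequence of virtual link diagrams $K=K_1\to K_2\to\dots\to K_n=K'$ such that every $K_i$ ($1\le i\le n$) has an orientable atom and, for each $2\le i\le n$, the diagram $K_i$ is obtained from $K_{i-1}$ by a (generalized) Reidemeister move.
   Context: A virtual link diagram is the image of a smooth immersion of a finite disjoint union of circles into $\mathbb{R}^2$ such that every intersection point is double and transverse and is marked either as a classical crossing (with overpass and underpass specified) or as a virtual crossing. Diagrams are considered up to planar isotopy. The generalized Reidemeister moves are the three classical Reidemeister moves (performed on classical crossings, in either direction) together with the detour move: an arc of the diagram containing only virtual crossings (possibly none) may be removed and redrawn as any other generic arc with the same endpoints, all new crossings of this arc being declared virtual. (Equivalently, the detour move may be replaced by the purely virtual versions of the three Reidemeister moves and the semivirtual version of the third move.) Two diagrams are equivalent if they are connected by a finite sequence of generalized Reidemeister moves. In the claim, ''Reidemeister move'' means any one of these moves, and planar isotopies are allowed freely. Frame of a diagram. To a virtual link diagram $L$ one associates a 4-valent graph $\Gamma(L)$: its vertices are the classical crossings of $L$ and its edges are the arcs of $L$ between consecutive classical crossings (virtual crossings are ignored). Components of $L$ with no classical crossings give circle components of $\Gamma(L)$ without vertices. This graph is framed: at each vertex, the four half-edges are split into two pairs of opposite half-edges, the two half-edges of the overpass being opposite and the two half-edges of the underpass being opposite. Atom. An atom is a pair $(P,\Gamma)$, where $P$ is a smooth closed compact 2-manifold and $\Gamma\subset P$ is an embedded 4-valent graph (the frame) splitting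 $P$ into cells, such that the cells can be divided into black and white ones so that every edge is incident to one black and one white cell. The atom is orientable if the surface $P$ is orientable. The atom of a virtual link diagram $L$ has frame $\Gamma(L)$ and is constructed as follows. At each classical crossing, call the two opposite angles swept by the overpass when it is rotated counterclockwise towards the underpass the $A$-angles, and the other two the $B$-angles. Attach a black disk to $\Gamma(L)$ along each closed curve in $\Gamma(L)$ that, at every crossing it passes, turns from one half-edge bounding an $A$-angle to the other half-edge bounding the same angle. Attach white disks in the same way using $B$-angles. To a circle component without vertices attach one black and one white disk. The surface $P$ may be disconnected when the frame is disconnected. Equivalently (a known fact), the atom of $L$ is orientable if and only if $\Gamma(L)$ admits a source-sink structure, that is, an orientation of all edges such that at every vertex two opposite half-edges are incoming and the other two are outgoing (circle components without vertices impose no condition). *)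

(* Defs.v *)
From HB Require Import structures.
From mathcomp Require Import all_boot all_order all_algebra all_fingroup.
From mathcomp Require Import all_classical all_reals all_analysis.

Set Implicit Arguments.
Unset Strict Implicit.
Unset Printing Implicit Defensive.

Import Order.TTheory GRing.Theory Num.Theory.
Import numFieldNormedType.Exports.

Local Open Scope classical_set_scope.
Local Open Scope ring_scope.

Section Diagrams.
Context {R : realType}.

(* [0 < det u v] iff the counterclockwise angle from u to v is in ]0, pi[. *)
Definition det (u v : R * R) : R := u.1 * v.2 - u.2 * v.1.

Section Components.
Variable n : nat.

(* A disjoint union of n circles is 'I_n * (R / Z); we work with lifts to
   'I_n * R, and [same_point] is equality in the quotient. *)
Definition point : Type := ('I_n * R)%type.

Definition same_point (x y : point) : Prop :=
  x.1 = y.1 /\ exists k : int, y.2 = x.2 + k%:~R.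

Definition smooth (g : R -> R * R) : Prop :=
  forall (k : nat) (t : R), derivable (derive1n k g) t 1.

(* A virtual link diagram with n components.  [over x y] says that the image of
   x and y is a classical crossing at which the branch through x is the
   overpass; an intersection point that carries no [over] is virtual. *)
Record diagram : Type := Diagram {
  curve : 'I_n -> R -> R * R;
  over : point -> point -> Prop;
  curve_periodic : forall i t, curve i (t + 1) = curve i t;
  curve_smooth : forall i, smooth (curve i);
  curve_immersion : forall i t, (curve i)^`()%classic t != 0;
  curve_double : forall x y z : point,
    curve x.1 x.2 = curve y.1 y.2 -> curve x.1 x.2 = curve z.1 z.2 ->
    [\/ same_point x y, same_point x z | same_point y z];
  curve_transverse : forall x y : point,
    curve x.1 x.2 = curve y.1 y.2 -> ~ same_point x y ->
    det ((curve x.1)^`()%classic x.2) ((curve y.1)^`()%classic y.2) != 0;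
  (* This field follows from the previous ones by compactness. *)
  curve_finite : finite_set [set x : point | 0 <= x.2 < 1 /\
    exists2 y : point, ~ same_point x y & curve x.1 x.2 = curve y.1 y.2];
  over_crossing : forall x y : point, over x y ->
    ~ same_point x y /\ curve x.1 x.2 = curve y.1 y.2;
  over_asym : forall x y : point, over x y -> ~ over y x;
  over_periodic : forall x x' y y' : point,
    same_point x x' -> same_point y y' -> over x y -> over x' y'
}.

Definition pos (K : diagram) (x : point) : R * R := curve K x.1 x.2.

Definition velocity (K : diagram) (x : point) : R * R :=
  (curve K x.1)^`()%classic x.2.

Definition crossing (K : diagram) (x y : point) : Prop :=
  ~ same_point x y /\ pos K x = pos K y.

Definition classical_crossing (K : diagram) (x y : point) : Prop :=
  over K x y \/ over K y x.

Definition classical_point (K : diagram) (x : point) : Prop :=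
  exists y, classical_crossing K x y.

End Components.

(* A closed surface glued from triangles, each of which has its corners labelled
   0, 1, 2: [adj k t t'] says that t and t' are glued, respecting labels, along
   the side opposite to the corner k.  As gluings respect labels, the labels
   orient each triangle, and two triangles sharing a side are coherently oriented
   iff exactly one of the two orientations is the one given by the labels. *)
Record surface : Type := Surface {
  triangle : Type;
  adj : 'I_3 -> triangle -> triangle -> Prop
}.

Definition orientable (S : surface) : Prop :=
  exists o : triangle S -> bool,
    forall (k : 'I_3) (t t' : triangle S), adj k t t' -> o t' = ~~ o t.

Section Atom.
Variables (n : nat) (K : diagram n).

(* A half-edge of the frame leaves a classical crossing along the branch through
   [he_point], in the direction of the parametrization iff [he_forward].  Each
   point of the circles is represented by its lift in [0, 1[. *)
Record half_edge : Type := HalfEdge {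
  he_point : point n;
  he_forward : bool;
  he_classical : classical_point K he_point;
  he_range : 0 <= he_point.2 < 1
}.

Definition he_tangent (h : half_edge) : R * R :=
  if he_forward h then velocity K (he_point h) else - velocity K (he_point h).

Definition edge_forward (h h' : half_edge) : Prop :=
  [/\ he_forward h, ~~ he_forward h', (he_point h).1 = (he_point h').1 &
    exists2 k : int, (he_point h).2 < (he_point h').2 + k%:~R &
      forall s : R, (he_point h).2 < s < (he_point h').2 + k%:~R ->
        ~ classical_point K ((he_point h).1, s)].

(* h and h' are the two ends of an edge of the frame. *)
Definition edge (h h' : half_edge) : Prop :=
  edge_forward h h' \/ edge_forward h' h.

(* In both definitions h is the half-edge on the overpass. *)
Definition A_angle (h h' : half_edge) : Prop :=
  over K (he_point h) (he_point h') /\ 0 < det (he_tangent h) (he_tangent h').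

Definition B_angle (h h' : half_edge) : Prop :=
  over K (he_point h) (he_point h') /\ det (he_tangent h) (he_tangent h') < 0.

(* Black disks ([true]) turn along A-angles, white disks along B-angles. *)
Definition angle (black : bool) (h h' : half_edge) : Prop :=
  if black then A_angle h h' \/ A_angle h' h
  else B_angle h h' \/ B_angle h' h.

(* The barycentric subdivision of the cell decomposition of the atom into
   vertices, edges and black and white disks.  The triangle (h, c) has as corners
   the vertex of h (0), the midpoint of the edge of h (1) and the centre of the
   disk of colour c along h (2); every half-edge bounds exactly one disk of each
   colour.  The spheres given by the circle components without vertices are
   left out, as they do not affect orientability. *)
Definition atom : surface := {|
  triangle := (half_edge * bool)%type;
  adj := fun k t t' =>
    match val k with
    | 0%N => t.2 = t'.2 /\ edge t.1 t'.1
    | 1%N => t.2 = t'.2 /\ angle t.2 t.1 t'.1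
    | _ => t.1 = t'.1 /\ t.2 != t'.2
    end |}.

End Atom.

Definition has_orientable_atom n (K : diagram n) : Prop := orientable (atom K).

Definition homeomorphism (h : R * R -> R * R) : Prop :=
  continuous h /\
  exists g : R * R -> R * R, [/\ continuous g, cancel h g & cancel g h].

(* An ambient isotopy; that it is indexed by R instead of [0, 1] is no
   restriction, as it can be extended by constants. *)
Definition ambient_isotopy (H : R * (R * R) -> R * R) : Prop :=
  [/\ continuous H, forall p, H (0, p) = p &
    forall t, homeomorphism (fun p => H (t, p))].

(* The lift to R of a homeomorphism of the circle R / Z. *)
Definition circle_homeo (r : R -> R) : Prop :=
  continuous r /\
  (({homo r : s t / s < t} /\ forall t, r (t + 1) = r t + 1) \/
   ({homo r : s t / s < t >-> t < s} /\ forall t, r (t + 1) = r t - 1)).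

(* Planar isotopy of the marked images of the immersions: the components are
   neither ordered nor oriented nor parametrized. *)
Definition isotopic n (K K' : diagram n) : Prop :=
  exists (H : R * (R * R) -> R * R) (s : {perm 'I_n}) (r : 'I_n -> R -> R),
    let f (x : point n) : point n := (s x.1, r x.1 x.2) in
    [/\ ambient_isotopy H,
        forall i, circle_homeo (r i),
        forall x, pos K' (f x) = H (1, pos K x) &
        forall x y, over K x y <-> over K' (f x) (f y)].

Section Moves.
Variable n : nat.

Record arc : Type := Arc {
  arc_comp : 'I_n;
  arc_begin : R;
  arc_end : R;
  arc_lt : arc_begin < arc_end;
  arc_short : arc_end < arc_begin + 1
}.

(* Points of an arc are given by their lift in [arc_begin, arc_end]. *)
Definition pt (a : arc) (t : R) : point n := (arc_comp a, t).

Definition in_carc (a : arc) (t : R) : Prop := arc_begin a <= t <= arc_end a.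
Definition in_oarc (a : arc) (t : R) : Prop := arc_begin a < t < arc_end a.

Definition carc (a : arc) : set (point n) :=
  [set x | exists2 t, in_carc a t & same_point x (pt a t)].
Definition oarc (a : arc) : set (point n) :=
  [set x | exists2 t, in_oarc a t & same_point x (pt a t)].

(* K and K' coincide except that the arc a is redrawn; its ends stay in place. *)
Definition agree_off (K K' : diagram n) (a : arc) : Prop :=
  [/\ forall x, ~ oarc a x -> pos K x = pos K' x,
      forall x y, ~ oarc a x -> ~ oarc a y -> (over K x y <-> over K' x y) &
      forall y, [/\ ~ crossing K (pt a (arc_begin a)) y,
                    ~ crossing K (pt a (arc_end a)) y,
                    ~ crossing K' (pt a (arc_begin a)) y &
                    ~ crossing K' (pt a (arc_end a)) y]].

(* The detour move. *)
Definition detour (K K' : diagram n) : Prop :=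
  exists a : arc, agree_off K K' a /\
    forall x, carc a x -> ~ classical_point K x /\ ~ classical_point K' x.

Definition closed_disk (phi : R * R -> R * R) : set (R * R) :=
  phi @` [set p | p.1 ^+ 2 + p.2 ^+ 2 <= 1].
Definition open_disk (phi : R * R -> R * R) : set (R * R) :=
  phi @` [set p | p.1 ^+ 2 + p.2 ^+ 2 < 1].

(* The disk meets K in the arcs whose union is C with interior O; they are
   properly embedded: only their ends are on the boundary of the disk. *)
Definition disk_meets (phi : R * R -> R * R) (K : diagram n)
    (C O : set (point n)) : Prop :=
  pos K @^-1` closed_disk phi = C /\ pos K @^-1` open_disk phi = O.

Definition simple_arc (K : diagram n) (a : arc) : Prop :=
  forall s t, in_carc a s -> in_carc a t -> ~ crossing K (pt a s) (pt a t).

Definition no_meet (K : diagram n) (a b : arc) : Prop :=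
  forall s t, in_carc a s -> in_carc b t -> ~ crossing K (pt a s) (pt b t).

Definition meet_once (K : diagram n) (a b : arc) (s t : R) : Prop :=
  [/\ in_oarc a s, in_oarc b t, crossing K (pt a s) (pt b t) &
    forall s' t', in_carc a s' -> in_carc b t' ->
      crossing K (pt a s') (pt b t') -> s' = s /\ t' = t].

(* Up to planar isotopy, each Reidemeister move redraws a single arc inside a
   disk.  The diagrams inside the disk are described by their crossings, which
   determines them up to isotopy of the disk. *)

(* The first move: creation of a kink with a classical crossing. *)
Definition reidemeister1 (K K' : diagram n) : Prop :=
  exists (phi : R * R -> R * R) (a : arc) (s t : R),
    [/\ homeomorphism phi, agree_off K K' a,
        disk_meets phi K (carc a) (oarc a),
        disk_meets phi K' (carc a) (oarc a) &
    [/\ simple_arc K a,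
        [/\ in_oarc a s, in_oarc a t & s < t],
        classical_crossing K' (pt a s) (pt a t) &
        forall s' t', in_carc a s' -> in_carc a t' -> s' < t' ->
          crossing K' (pt a s') (pt a t') -> s' = s /\ t' = t]].

(* The second move: two disjoint arcs come to overlap, one of them being above
   the other at both crossings. *)
Definition reidemeister2 (K K' : diagram n) : Prop :=
  exists (phi : R * R -> R * R) (a b : arc) (s1 s2 t1 t2 : R),
    let C := carc a `|` carc b in
    let O := oarc a `|` oarc b in
    [/\ [/\ homeomorphism phi, agree_off K K' a & carc a `&` carc b = set0],
        disk_meets phi K C O /\ disk_meets phi K' C O,
        [/\ simple_arc K a, simple_arc K b, simple_arc K' a & simple_arc K' b],
        no_meet K a b &
    [/\ [/\ in_oarc a s1, in_oarc a s2 & s1 < s2],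
        in_oarc b t1 /\ in_oarc b t2,
        crossing K' (pt a s1) (pt b t1) /\ crossing K' (pt a s2) (pt b t2),
        forall s t, in_carc a s -> in_carc b t ->
          crossing K' (pt a s) (pt b t) ->
          (s = s1 /\ t = t1) \/ (s = s2 /\ t = t2) &
        (over K' (pt a s1) (pt b t1) /\ over K' (pt a s2) (pt b t2)) \/
        (over K' (pt b t1) (pt a s1) /\ over K' (pt b t2) (pt a s2))]].

(* The three pairwise intersections of arcs a, b, c, where ab is the point of a
   lying on b, etc.: either all three are classical and the arcs lie at
   three different levels (the classical third move), or exactly one is
   classical (the semivirtual third move). *)
Definition third_move_marks (K : diagram n) (ab ba ac ca bc cb : point n) :=
  [/\ classical_crossing K ab ba, classical_crossing K ac ca,
      classical_crossing K bc cb,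
      ~ [/\ over K ab ba, over K bc cb & over K ca ac] &
      ~ [/\ over K ba ab, over K cb bc & over K ac ca]] \/
  [\/ [/\ classical_crossing K ab ba, ~ classical_crossing K ac ca &
          ~ classical_crossing K bc cb],
      [/\ ~ classical_crossing K ab ba, classical_crossing K ac ca &
          ~ classical_crossing K bc cb] |
      [/\ ~ classical_crossing K ab ba, ~ classical_crossing K ac ca &
          classical_crossing K bc cb]].

(* The third move: the arc a passes to the other side of the intersection of b
   and c, so that each of the three arcs meets the other two in the opposite
   order. The semivirtual version is, up to planar isotopy, a detour of the arc
   with two virtual crossings, but not of a if a has the classical crossing. *)
Definition reidemeister3 (K K' : diagram n) : Prop :=
  exists (phi : R * R -> R * R) (a b c : arc)
         (ab ba ac ca bc cb ab' ba' ac' ca' : R),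
    let C := carc a `|` carc b `|` carc c in
    let O := oarc a `|` oarc b `|` oarc c in
    [/\ [/\ homeomorphism phi, agree_off K K' a & carc a `&` carc b = set0 /\
            carc a `&` carc c = set0 /\ carc b `&` carc c = set0],
        disk_meets phi K C O /\ disk_meets phi K' C O,
        forall d, d = a \/ d = b \/ d = c -> simple_arc K d /\ simple_arc K' d,
        [/\ meet_once K a b ab ba, meet_once K a c ac ca,
            meet_once K b c bc cb, meet_once K' a b ab' ba' &
            meet_once K' a c ac' ca'] &
    [/\ [/\ (ab < ac) = (ac' < ab'), (ba < bc) = (bc < ba') &
            (ca < cb) = (cb < ca')],
        third_move_marks K (pt a ab) (pt b ba) (pt a ac) (pt c ca)
          (pt b bc) (pt c cb),
        (over K (pt a ab) (pt b ba) <-> over K' (pt a ab') (pt b ba')) /\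
        (over K (pt b ba) (pt a ab) <-> over K' (pt b ba') (pt a ab')) &
        (over K (pt a ac) (pt c ca) <-> over K' (pt a ac') (pt c ca')) /\
        (over K (pt c ca) (pt a ac) <-> over K' (pt c ca') (pt a ac'))]].

Definition basic_move (K K' : diagram n) : Prop :=
  [\/ reidemeister1 K K', reidemeister2 K K', reidemeister3 K K' |
      detour K K'].

(* A generalized Reidemeister move between diagrams up to planar isotopy. *)
Definition reidemeister_move (K K' : diagram n) : Prop :=
  exists X Y : diagram n,
    [/\ isotopic K X, basic_move X Y \/ basic_move Y X & isotopic Y K'].

Definition equivalent (K K' : diagram n) : Prop :=
  exists (N : nat) (D : nat -> diagram n),
    [/\ D 0%N = K, D N = K' &
      forall i : nat, (i < N)%N -> reidemeister_move (D i) (D i.+1)].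

End Moves.

End Diagrams.

Arguments diagram R n : clear implicits.

(* Main.v *)
From HB Require Import structures.
From mathcomp Require Import all_boot all_order all_algebra all_fingroup.
From mathcomp Require Import finmap.
From mathcomp Require Import all_classical all_reals all_analysis.
From mathcomp Require Import lra.
Require Import Defs.

(* A source-sink structure amounts to a boolean labelling of the circles that
   changes at every classical point and takes different values at the two points
   of every classical crossing.  A labelling satisfying only the first condition
   can be carried along any Reidemeister move, and if one makes virtual all
   crossings whose two labels agree, then moves become moves.  Starting from the
   source-sink structure of K and iterating until nothing changes, one joins K
   through orientable diagrams to a diagram obtained from K' by making some
   crossings virtual.

   If the labels carried from K to K' differ from the source-sink structure of K'
   by a function a of the components that is not constant, then no crossing between
   components with different values of a survives.  The same construction starting
   from K' gives a diagram obtained from K in which these crossings are virtual as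
   well, and the two diagrams so obtained are joined by induction on the number of
   pairs of components that are allowed to cross. *)

Set Implicit Arguments.
Unset Strict Implicit.
Unset Printing Implicit Defensive.

Import Order.TTheory GRing.Theory Num.Theory.
Import numFieldNormedType.Exports.

(** The construction is a Gaussian parity projection: on a knot, the two labels at a crossing agree
    iff its chord in the Gauss diagram meets an odd number of other chords. Labels can be carried
    across a move because every arc in the disk keeps the parity of its number of classical points.
    Virtualization respects moves because the crossing of a kink always survives, the two crossings
    of a second move survive or vanish together, and of three classical crossings in a third move an
    odd number survives, so that the forbidden triangle with exactly one virtual crossing never
    arises. A move that loses all its crossings is a detour. One pass need not suffice: the old
    labels still flip at points that have become virtual, so they are no labelling of the new
    diagrams and new labels must be carried. The total number of classical points drops with each
    pass that changes something, which bounds the iteration. Planar isotopies may permute and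
    reverse components; the permutations are recorded throughout, since functions of the components
    have to be transported along the moves. *)

Section OneSidedNeighbourhoods.
Local Open Scope classical_set_scope.
Local Open Scope ring_scope.
Context {R : realType}.
Implicit Types (s t b e : R) (P : R -> Prop) (l : seq R).

Lemma near_rightP s P :
  (\forall t \near s^'+, P t) <-> exists2 m, s < m & forall t, s < t < m -> P t.
Proof.
split=> [|[m sm mP]]; last first.
  near=> t; apply: mP; apply/andP; split; near: t.
    exact: nbhs_right_gt.
  exact: nbhs_right_lt.
move=> [/= d d0 dP]; exists (s + d); first by rewrite ltrDl.
move=> t /andP[st td]; apply: dP => //=.
by rewrite ltr_distlC; apply/andP; split=> //; lra.
Unshelve. all: by end_near. Qed.

Lemma near_leftP s P :
  (\forall t \near s^'-, P t) <-> exists2 m, m < s & forall t, m < t < s -> P t.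
Proof.
split=> [|[m sm mP]]; last first.
  near=> t; apply: mP; apply/andP; split; near: t.
    exact: nbhs_left_gt.
  exact: nbhs_left_lt.
move=> [/= d d0 dP]; exists (s - d); first by lra.
move=> t /andP[st td]; apply: dP => //=.
by rewrite ltr_distlC; apply/andP; split=> //; lra.
Unshelve. all: by end_near. Qed.

Lemma near_right_count s l : \forall t \near s^'+,
  count (fun u => u < t) l = (count (fun u => u < s)%R l + count_mem s l)%N.
Proof.
elim: l => [|u l IHl]; first exact: nearW.
have tu : \forall t \near s^'+, (u < t) = ((u < s)%R + (u == s))%N :> nat.
  case: (ltgtP u s) => [us|su|->]; near=> t.
  - suff -> : u < t by [].
    by apply: lt_trans us _; near: t; exact: nbhs_right_gt.
  - suff : t < u by move=> /ltW; rewrite ltNge => ->.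
    by near: t; exact: nbhs_right_lt.
  - suff -> : s < t by [].
    by near: t; exact: nbhs_right_gt.
near=> t => /=; rewrite addnACA; congr addn; first by near: t.
by near: t.
Unshelve. all: by end_near. Qed.

Lemma near_left_count s l : \forall t \near s^'-,
  count (fun u => u < t) l = count (fun u => u < s) l.
Proof.
elim: l => [|u l IHl]; first exact: nearW.
have tu : \forall t \near s^'-, (u < t) = (u < s)%R :> nat.
  case: (ltP u s) => us; near=> t.
    suff -> : u < t by [].
    by near: t; exact: nbhs_left_gt.
  suff /ltW ts : t < s by rewrite ltNge (le_trans ts us).
  by near: t; exact: nbhs_left_lt.
near=> t => /=; congr addn; near: t.
  exact: tu.
exact: IHl.
Unshelve. all: by end_near. Qed.

(** Supremum of the [u] such that [d] is [v] on all of []b, u[]. The one-sided hypotheses let [d]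
    jump at [b] and say nothing to the right of [e], which fits a label followed along an edge that
    starts and ends at classical points. *)
Lemma locally_constant_eq (T : Type) (d : R -> T) (v : T) b e :
  b < e -> (\forall t \near b^'+, d t = v) ->
  (forall s, b < s <= e -> \forall t \near s^'-, d t = d s) ->
  (forall s, b < s < e -> \forall t \near s^'+, d t = d s) ->
  d e = v.
Proof.
move=> be /near_rightP[m bm mP] dl dr.
pose S := [set u | b < u <= e /\ forall w, b < w < u -> d w = v].
have S0 : S (Num.min m e).
  split=> [|w /andP[bw]]; first by rewrite lt_min bm be ge_min lexx orbT.
  by rewrite lt_min => /andP[wm _]; apply: mP; rewrite bw.
have Sne : S !=set0 by exists (Num.min m e).
have ubS : ubound S e by move=> u [/andP[]].
have supS : has_sup S by split=> //; exists e.
set M := sup S.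
have bM : b < M.
  apply: (@lt_le_trans _ _ (Num.min m e)); first by rewrite lt_min bm be.
  by apply: ub_le_sup => //; exists e.
have Me : M <= e by apply: ge_sup.
have belowM w : b < w < M -> d w = v.
  move=> /andP[bw wM]; have [u [_ uP] wu] := sup_gt Sne wM.
  by apply: uP; rewrite bw.
have dM : d M = v.
  have /near_leftP[w wM wP] : \forall t \near M^'-, d t = d M.
    by apply: dl; rewrite bM.
  have [t] : exists t, Num.max w b < t < M.
    have : Num.max w b < M by rewrite gt_max wM bM.
    by exists ((Num.max w b + M) / 2); apply/andP; split; lra.
  rewrite gt_max -andbA => /and3P[wt bt tM].
  by rewrite -(wP t) ?wt // belowM // bt.
have [eM|Me'] := leP e M; first by rewrite (_ : e = M) //; apply/le_anti/andP.
have /near_rightP[w Mw wP] : \forall t \near M^'+, d t = d M.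
  by apply: dr; rewrite bM.
suff : Num.min w e <= M by rewrite leNgt lt_min Mw Me'.
apply: ub_le_sup; first by exists e.
split=> [|t /andP[bt]].
  by rewrite lt_min (lt_trans bM Mw) be ge_min lexx orbT.
rewrite lt_min => /andP[tw te]; case: (ltgtP t M) => [tM|Mt|->] //.
  by apply: belowM; rewrite bt.
by rewrite wP // Mt.
Qed.

End OneSidedNeighbourhoods.

(** * Labellings of circles *)

Section Labellings.
Local Open Scope classical_set_scope.
Local Open Scope ring_scope.
Context {R : realType} {n : nat}.
Local Notation point := (@point R n).
Local Notation arc := (@arc R n).
Implicit Types (x y z : point) (C : point -> Prop) (E : point -> bool).
Implicit Types (a : arc) (l T : seq R).

Lemma same_point_refl x : same_point x x.
Proof. by split=> //; exists 0; rewrite addr0. Qed.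

Lemma same_point_sym x y : same_point x y -> same_point y x.
Proof.
by move=> [xy [k yx]]; split=> //; exists (- k); rewrite yx mulrNz addrK.
Qed.

Lemma same_point_trans x y z : same_point x y -> same_point y z -> same_point x z.
Proof.
move=> [xy [k yx]] [yz [m zy]]; split; first by rewrite xy.
by exists (k + m); rewrite zy yx intrD addrA.
Qed.

Lemma same_point_shift i (t : R) (k : int) : same_point (i, t + k%:~R) ((i, t) : point).
Proof. by apply: same_point_sym; split=> //; exists k. Qed.

Lemma int_small_eq0 (k : int) : -1 < k%:~R :> R -> k%:~R < 1 :> R -> k = 0.
Proof.
move=> k1 k2; have {}k1 : -1 < k by rewrite -(ltr_int R) mulrNz.
have {}k2 : k < 1 by rewrite -(ltr_int R).
by apply/le_anti; rewrite -ltzD1 k2 -[0](addNr 1) lezD1 k1.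
Qed.

Lemma same_point_close i (s t : R) :
  same_point ((i, s) : point) (i, t) -> -1 < t - s -> t - s < 1 -> s = t.
Proof.
move=> [_ [k /= ->]]; rewrite addrAC subrr add0r => k1 k2.
by rewrite (int_small_eq0 k1 k2) addr0.
Qed.

(** The representative of [t] modulo 1 in [[b, b + 1[]. With [b] the beginning of an arc, the arc
    lies uncut in this window. *)
Definition circle_lift (b t : R) : R := t - (Num.floor (t - b))%:~R.

Lemma lift_itv b t : b <= circle_lift b t < b + 1.
Proof.
by have := Num.Theory.floor_itv (t - b); rewrite /circle_lift intrD => /andP[? ?]; apply/andP; split; lra.
Qed.

Lemma lift_same b i t : same_point ((i, t) : point) (i, circle_lift b t).
Proof. by split=> //; exists (- Num.floor (t - b)); rewrite mulrNz. Qed.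

Lemma lift_eq b u t i : b <= u < b + 1 ->
  same_point ((i, t) : point) (i, u) -> circle_lift b t = u.
Proof.
move=> /andP[bu ub] tu; have /andP[bt tb] := lift_itv b t.
by apply: (@same_point_close i _ _ (same_point_trans (same_point_sym (lift_same b i t)) tu)); lra.
Qed.

Lemma liftD1 b t : circle_lift b (t + 1) = circle_lift b t.
Proof.
have i : 'I_1 := ord0.
suff : Defs.same_point ((i, t + 1) : Defs.point 1) (i, circle_lift b t).
  move=> [_ [k kE]]; rewrite /circle_lift.
  have -> : Num.floor (t + 1 - b) = Num.floor (t - b) + 1.
    by rewrite addrAC Num.Theory.floorDrz ?Num.Theory.floor1 // rpred1.
  by rewrite intrD; lra.
split=> //; exists (- (1 + Num.floor (t - b))).
by rewrite mulrNz intrD /circle_lift /=; lra.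
Qed.

(* The label of a point of [C] is that of the edge ending at it; [true] stands for
   the orientation of the edge given by the parametrization. *)
Definition labelling C E := forall i, (forall t, E (i, t + 1) = E (i, t)) /\
  forall s, (\forall t \near s^'-, E (i, t) = E (i, s)) /\
    (\forall t \near s^'+, E (i, t) = E (i, s) (+) `[< C (i, s) >]).

Lemma labelling_same C E x y : labelling C E -> same_point x y -> E x = E y.
Proof.
case: x y => i s [j t] CE [/= <- [k ->]].
have EN (m : nat) u : E (i, u + m%:R) = E (i, u).
  elim: m => [|m IHm]; first by rewrite addr0.
  by rewrite -[m.+1]addn1 natrD addrA (CE i).1.
case: k => m; first by rewrite -[Posz m]/(m%:Z) -pmulrn EN.
by rewrite NegzE mulrNz -pmulrn -[in LHS](subrK (m.+1)%:R s) EN.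
Qed.

Lemma labelling_ext C C' E : (forall x, C x <-> C' x) ->
  labelling C E -> labelling C' E.
Proof. by move=> CC'; have -> : C = C' by apply/funext => x; apply/propext. Qed.

Lemma labelling_addb C E (c : 'I_n -> bool) :
  labelling C E -> labelling C (fun x => E x (+) c x.1).
Proof.
move=> CE i; split=> [t|s] /=; first by rewrite (CE i).1.
have [El Er] := (CE i).2 s; split; first by near=> t; congr addb; near: t.
by near=> t; rewrite addbAC; congr addb; near: t.
Unshelve. all: by end_near. Qed.

(** Both labellings flip at the same points, so their difference is locally constant. Two labellings
    thus differ by a function of the components, which is the obstruction met at the very end. *)
Lemma labelling_diff C E E' i s t : labelling C E -> labelling C E' ->
  E (i, s) (+) E' (i, s) = E (i, t) (+) E' (i, t).
Proof.
move=> CE CE'; wlog st : s t / s < t.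
  by move=> H; case: (ltgtP s t) => [/H//|/H//|->].
pose d u := E (i, u) (+) E' (i, u).
have dl u : \forall w \near u^'-, d w = d u.
  have [El _] := (CE i).2 u; have [El' _] := (CE' i).2 u.
  by near=> w; congr addb; near: w.
have dr u : \forall w \near u^'+, d w = d u.
  have [_ Er] := (CE i).2 u; have [_ Er'] := (CE' i).2 u.
  near=> w; rewrite /d.
  have -> : E (i, w) = E (i, u) (+) `[< C (i, u) >] by near: w.
  have -> : E' (i, w) = E' (i, u) (+) `[< C (i, u) >] by near: w.
  by rewrite addbACA addbb addbF.
by apply/esym; apply: (@locally_constant_eq _ _ d (d s) s t).
Unshelve. all: by end_near. Qed.

Definition marked_points a C l :=
  [/\ uniq l, forall u, u \in l -> in_oarc a u &
    forall u, in_oarc a u -> (C (pt a u) <-> u \in l)].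

Lemma oarc_lift a x : oarc a x <->
  x.1 = arc_comp a /\ in_oarc a (circle_lift (arc_begin a) x.2).
Proof.
have ab := arc_short a; case: x => i t; split=> [[u au xu]|[/= -> at_]]; last first.
  by exists (circle_lift (arc_begin a) t) => //; exact: lift_same.
have [/= ia _] := xu; split=> //=; subst i; have /andP[bu ue] := au.
by rewrite (lift_eq _ xu) // (ltW bu); lra.
Qed.

Lemma count_lt_lb b l : (forall v, v \in l -> b < v) ->
  count (fun v => v < b) l = 0%N.
Proof.
move=> lb; apply/eqP; rewrite -leqn0 leqNgt -has_count; apply/hasPn => v /lb bv.
by rewrite -leNgt ltW.
Qed.

(** The label flips once at every mark passed. Marks are counted strictly before [u] because a
    marked point carries the label of its incoming edge; a mark at the beginning of the arc is
    accounted for separately. *)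
Lemma arc_value C E a l u : labelling C E -> marked_points a C l ->
  arc_begin a < u <= arc_end a ->
  E (pt a u) = E (pt a (arc_begin a)) (+) `[< C (pt a (arc_begin a)) >]
    (+) odd (count (fun w => w < u) l).
Proof.
move=> CE [lu la lC] /andP[bu ue]; set i := arc_comp a in lC *.
pose d w := E (i, w) (+) odd (count (fun v => v < w) l).
apply: (canRL (addbK _)); apply: (@locally_constant_eq _ _ d _ (arc_begin a) u) => //.
- have [_ Er] := (CE i).2 (arc_begin a); have cr := near_right_count (arc_begin a) l.
  near=> w; rewrite /d.
  have -> : count (fun v => v < w) l
    = (count (fun v => v < arc_begin a)%R l + count_mem (arc_begin a) l)%N by near: w.
  have -> : E (i, w) = E (i, arc_begin a) (+) `[< C (i, arc_begin a) >] by near: w.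
  rewrite count_lt_lb => [|v /la /andP[]//].
  have /count_memPn -> : arc_begin a \notin l; last by rewrite addbF.
  by apply/negP => /la; rewrite /in_oarc ltxx.
- move=> s _; have [El _] := (CE i).2 s; have cl := near_left_count s l.
  near=> w; rewrite /d; congr addb; first by near: w.
  by congr odd; near: w.
move=> s /andP[bs su]; have [_ Er] := (CE i).2 s; have cr := near_right_count s l.
have as_ : in_oarc a s by rewrite /in_oarc bs (lt_le_trans su ue).
near=> w; rewrite /d.
have -> : count (fun v => v < w) l
  = (count (fun v => v < s)%R l + count_mem s l)%N by near: w.
have -> : E (i, w) = E (i, s) (+) `[< C (i, s) >] by near: w.
rewrite oddD count_uniq_mem // oddb.
have -> : `[< C (i, s) >] = (s \in l).
  by apply/asboolP/idP => /(lC _ as_).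
by rewrite addbACA addbC [(s \in l) (+) _]addbb.
Unshelve. all: by end_near. Qed.

Definition periodic C := forall x y, same_point x y -> C x -> C y.

(** Add to [E] the parity of the number of marks, old and new, already passed on the arc. The total
    number of marks is even, so this correction is back to zero at the end of the arc and nothing
    changes outside. *)
Lemma relabel C C' E a l l' : periodic C -> periodic C' ->
  marked_points a C l -> marked_points a C' l' -> odd (size l) = odd (size l') ->
  (forall x, ~ oarc a x -> (C x <-> C' x)) -> labelling C E ->
  exists2 E', labelling C' E' & forall x, ~ oarc a x -> E x = E' x.
Proof.
move=> pC pC' [lu la lC] [lu' la' lC'] ll' CC' CE.
set b := arc_begin a; set T := l ++ l'.
have Ta u : u \in T -> b < u < arc_end a.
  by rewrite mem_cat => /orP[/la|/la'].
have T2 : odd (size T) = false by rewrite size_cat oddD ll' addbb.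
pose f u := odd (count (fun w => w < u) T).
have fb : f b = false.
  by rewrite /f count_lt_lb // => v /Ta/andP[].
have fe u : arc_end a <= u -> f u = false.
  move=> eu; rewrite /f (_ : count _ _ = size T) //.
  apply/eqP; rewrite -all_count; apply/allP => v /Ta/andP[_ ve].
  exact: lt_le_trans eu.
pose E' x := E x (+) ((x.1 == arc_comp a) && f (circle_lift b x.2)).
have E'off x : ~ oarc a x -> E x = E' x.
  move=> xa; rewrite /E'; case: eqP => //= [xa1|]; last by rewrite addbF.
  have /andP[bx xb] := lift_itv b x.2.
  have [xe|ex] := ltP (circle_lift b x.2) (arc_end a); last by rewrite fe // addbF.
  move: bx; rewrite le_eqVlt => /predU1P[<-|bx]; first by rewrite fb addbF.
  by exfalso; apply: xa; apply/oarc_lift; split=> //; rewrite /in_oarc bx.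
(* A point marked in both lists occurs twice in [T], so its two flips cancel: [T] modulo 2 is the
   symmetric difference of the marks. *)
have Cmem u : b <= u < b + 1 ->
    `[< C' (arc_comp a, u) >] = `[< C (arc_comp a, u) >] (+) odd (count_mem u T).
  move=> bu; have [au|au] := boolP (b < u < arc_end a).
    rewrite count_cat !count_uniq_mem // oddD !oddb.
    have -> : `[< C (arc_comp a, u) >] = (u \in l) by apply/asboolP/idP => /(lC _ au).
    have -> : `[< C' (arc_comp a, u) >] = (u \in l') by apply/asboolP/idP => /(lC' _ au).
    by rewrite addKb.
  have -> : count_mem u T = 0%N.
    by apply/count_memPn; apply/negP => /Ta; apply/negP.
  rewrite addbF; apply: asbool_equiv_eq; split=> Cu; apply/CC' => //.
    move=> /oarc_lift[_ /=]; rewrite (lift_eq bu (same_point_refl (arc_comp a, u))).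
    exact/negP.
  move=> /oarc_lift[_ /=]; rewrite (lift_eq bu (same_point_refl (arc_comp a, u))).
  exact/negP.
exists E' => // i; split=> [t|s]; first by rewrite /E' /= liftD1 (CE i).1.
have [El Er] := (CE i).2 s; rewrite /E' /=.
case: (eqVneq i (arc_comp a)) => [ia|ia] /=; last first.
  split; first by near=> t; congr addb; near: t.
  near=> t; rewrite !addbF (_ : `[< C' (i, s) >] = `[< C (i, s) >]); first by near: t.
  by apply: asbool_equiv_eq; split=> Cs; apply/CC' => // -[? _ [/= /eqP]]; rewrite (negbTE ia).
subst i; set i := arc_comp a in El Er *; set u := circle_lift b s.
have bu : b <= u < b + 1 := lift_itv b s; have su := lift_same b i s.
have liftE t : b <= u + (t - s) < b + 1 -> circle_lift b t = u + (t - s).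
  move=> btb; apply: (lift_eq (i := i) btb); split=> //.
  exists (- Num.floor (s - b)); rewrite /= /u /circle_lift mulrNz; lra.
split.
  suff fl : \forall t \near s^'-, f (circle_lift b t) = f u.
    by near=> t; congr addb; near: t.
  have /andP[+ ub] := bu; rewrite le_eqVlt => /predU1P[bu0|bu'].
    have fu : f u = false by rewrite -bu0.
    apply/near_leftP.
    (* When [s] projects to the beginning of the arc, the points just before it wrap around to the
       gap between the end of the arc and [b + 1], where [f] vanishes. The radius is the length of
       this gap, positive by [arc_short]. *)
    exists (s - (b + 1 - arc_end a)).
      by have := arc_short a; rewrite -/b; lra.
    move=> t /andP[t1 t2]; rewrite fu; apply: fe.
    have -> : circle_lift b t = b + 1 + (t - s); last lra.
    apply: (@lift_eq b _ t i).
      by have := arc_lt a; rewrite -/b => ?; apply/andP; split; lra.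
    split=> //; exists (1 - Num.floor (s - b)).
    by rewrite /= intrB; move: bu0; rewrite /u /circle_lift; lra.
  have /near_leftP[w wu wP] := near_left_count u T.
  apply/near_leftP; exists (s - Num.min (u - w) (u - b)).
    by rewrite ltrBlDr ltrDl lt_min !subr_gt0 wu.
  move=> t /andP[]; rewrite ltrBlDr -ltrBlDl lt_min => /andP[t1 t2] ts.
  rewrite liftE; last by apply/andP; split; lra.
  by rewrite /f wP //; apply/andP; split; lra.
have /near_rightP[w wu wP] := near_right_count u T; have /andP[bu1 bu2] := bu.
have fr : \forall t \near s^'+, f (circle_lift b t) = f u (+) odd (count_mem u T).
  apply/near_rightP; exists (s + Num.min (w - u) (b + 1 - u)).
    by rewrite ltrDl lt_min !subr_gt0 wu.
  move=> t /andP[st]; rewrite -ltrBlDl lt_min => /andP[t1 t2].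
  rewrite liftE; last by apply/andP; split; lra.
  by rewrite /f wP ?oddD //; apply/andP; split; lra.
have -> : `[< C' (i, s) >] = `[< C (i, s) >] (+) odd (count_mem u T).
  have -> : `[< C (i, s) >] = `[< C (i, u) >].
    by apply: asbool_equiv_eq; split; apply: pC => //; exact: same_point_sym.
  rewrite -(Cmem u bu); apply: asbool_equiv_eq; split; apply: pC' => //.
  exact: same_point_sym.
near=> t; rewrite addbACA; congr addb; near: t; [exact: Er | exact: fr].
Unshelve. all: by end_near. Qed.

End Labellings.

(** * Virtualization and orientability *)

Section Diagrams.
Local Open Scope classical_set_scope.
Local Open Scope ring_scope.
Context {R : realType} {n : nat}.
Local Notation point := (@point R n).
Local Notation arc := (@arc R n).
Local Notation diagram := (diagram R n).
Implicit Types (K : diagram) (x y z : point) (E : point -> bool).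

(** Proof irrelevance for the fields that are propositions. A genuine equality is wanted so that an
    end of a chain that loses no crossing can be rewritten into the original diagram. *)
Lemma diagram_eq K K' : curve K = curve K' -> over K = over K' -> K = K'.
Proof.
case: K K' => [c o ? ? ? ? ? ? ? ? ?] [c' o' ? ? ? ? ? ? ? ? ?] /= cc oo.
by subst c' o'; f_equal; exact: Prop_irrelevance.
Qed.

Lemma pos_same K x y : same_point x y -> pos K x = pos K y.
Proof.
case: x y => i s [j t] [/= <- [k ->]].
have EN (m : nat) u : pos K (i, u + m%:R) = pos K (i, u).
  elim: m => [|m IHm]; first by rewrite addr0.
  by rewrite -[m.+1]addn1 natrD addrA -IHm; exact: curve_periodic.
case: k => m; first by rewrite -[Posz m]/(m%:Z) -pmulrn EN.
by rewrite NegzE mulrNz -pmulrn -[in LHS](subrK (m.+1)%:R s) EN.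
Qed.

Lemma over_same K x x' y y' : same_point x x' -> same_point y y' ->
  over K x y <-> over K x' y'.
Proof.
move=> xx yy; split; first exact: over_periodic.
by apply: over_periodic; exact: same_point_sym.
Qed.

Lemma classical_point_periodic K : periodic (classical_point K).
Proof.
move=> x x' xx [y xy]; exists y; case: xy => xy; [left|right].
  exact: over_periodic xx (same_point_refl y) xy.
exact: over_periodic (same_point_refl y) xx xy.
Qed.

Lemma over_classicall K x y : over K x y -> classical_point K x.
Proof. by move=> xy; exists y; left. Qed.

Lemma over_classicalr K x y : over K x y -> classical_point K y.
Proof. by move=> xy; exists x; right. Qed.

Lemma crossing_sym K x y : crossing K x y -> crossing K y x.
Proof. by move=> [xy e]; split=> // /same_point_sym. Qed.

Lemma classical_crossing_crossing K x y : classical_crossing K x y -> crossing K x y.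
Proof. by case=> /over_crossing[xy e]; split=> // /same_point_sym. Qed.

Lemma crossing_unique K x y z : crossing K x y -> crossing K x z -> same_point y z.
Proof.
move=> [xy exy] [xz exz].
by have [||] := curve_double exy exz.
Qed.

Definition norm_point x : point := (x.1, circle_lift 0 x.2).

Lemma norm_point_same x : same_point x (norm_point x).
Proof. by case: x => i t; exact: lift_same. Qed.

Lemma norm_point_range x : 0 <= (norm_point x).2 < 1.
Proof. by have := lift_itv 0 x.2; rewrite add0r. Qed.

Lemma norm_point_eq x y : same_point x y -> norm_point x = norm_point y.
Proof.
case: x y => i s [j t] xy; have [/= ij _] := xy; subst j; congr pair => /=.
apply: (lift_eq (i := i) (lift_itv 0 t)).
exact: same_point_trans xy (lift_same 0 i t).
Qed.

(** Evaluating [E] at normalized points makes this relation periodic for an arbitrary [E], so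
    [virtualize] is total and takes no proof; for a labelling the normalization disappears by
    [over_virtualize]. *)
Definition virtual_over K E x y :=
  over K x y /\ E (norm_point x) != E (norm_point y).

Lemma virtual_over_crossing K E x y : virtual_over K E x y ->
  ~ same_point x y /\ curve K x.1 x.2 = curve K y.1 y.2.
Proof. by move=> [/over_crossing]. Qed.

Lemma virtual_over_asym K E x y : virtual_over K E x y -> ~ virtual_over K E y x.
Proof. by move=> [/over_asym xy _] []. Qed.

Lemma virtual_over_periodic K E x x' y y' :
  same_point x x' -> same_point y y' -> virtual_over K E x y -> virtual_over K E x' y'.
Proof.
move=> xx yy [xy Exy]; split; first exact: over_periodic xx yy xy.
by rewrite -(norm_point_eq xx) -(norm_point_eq yy).
Qed.

Definition virtualize K E : diagram := {|
  curve := curve K;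
  over := virtual_over K E;
  curve_periodic := @curve_periodic R n K;
  curve_smooth := @curve_smooth R n K;
  curve_immersion := @curve_immersion R n K;
  curve_double := @curve_double R n K;
  curve_transverse := @curve_transverse R n K;
  curve_finite := @curve_finite R n K;
  over_crossing := @virtual_over_crossing K E;
  over_asym := @virtual_over_asym K E;
  over_periodic := @virtual_over_periodic K E |}.

Definition labels K E := labelling (classical_point K) E.

Definition source_sink K E := forall x y, over K x y -> E x != E y.

Lemma over_virtualize K E x y : labels K E ->
  over (virtualize K E) x y <-> over K x y /\ E x != E y.
Proof.
move=> KE; rewrite /= /virtual_over.
by rewrite -(labelling_same KE (norm_point_same x)) -(labelling_same KE (norm_point_same y)).
Qed.

Lemma classical_crossing_virtualize K E x y : labels K E ->
  classical_crossing (virtualize K E) x y <-> classical_crossing K x y /\ E x != E y.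
Proof.
move=> KE; rewrite /classical_crossing !over_virtualize // [E y == E x]eq_sym.
by tauto.
Qed.

Lemma virtualize_id K E : labels K E -> source_sink K E -> virtualize K E = K.
Proof.
move=> KE ss; apply: diagram_eq => //; apply/funext => x; apply/funext => y.
by apply/propext; rewrite over_virtualize //; split=> [[]|xy] //; split=> //; exact: ss.
Qed.

Definition classical_domain K : set ('I_n * R) :=
  [set x : 'I_n * R | 0 <= x.2 < 1 /\ classical_point K x].

Lemma classical_domain_finite K : finite_set (classical_domain K).
Proof.
apply: sub_finite_set (curve_finite K) => x [x01 [y xy]]; split=> //.
by exists y; have [] := classical_crossing_crossing xy.
Qed.

Definition classical_count K : nat := #|` fset_set (classical_domain K)|%fset.

Lemma virtualize_classical_domain K E :
  classical_domain (virtualize K E) `<=` classical_domain K.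
Proof.
move=> x [x01 [y xy]]; split=> //; exists y.
by case: xy => [[xy _]|[xy _]]; [left|right].
Qed.

Lemma classical_count_virtualize K E :
  (classical_count (virtualize K E) <= classical_count K)%N.
Proof.
apply/fsubset_leq_card/fsubsetP => x; rewrite !in_fset_set ?inE; last 2 first.
- exact: classical_domain_finite.
- exact: classical_domain_finite.
exact: virtualize_classical_domain.
Qed.

(** If the count did not drop, the two finite sets of classical points would coincide. Then every
    classical point would still lie on a surviving crossing, which is its original one since all
    intersections are double, and every crossing would have different labels. *)
Lemma classical_count_virtualize_lt K E : labels K E -> ~ source_sink K E ->
  (classical_count (virtualize K E) < classical_count K)%N.
Proof.
move=> KE nss; apply: contrapT => /negP; rewrite -leqNgt => le.
apply: nss => x y xy.
have sub : (fset_set (classical_domain (virtualize K E)) `<=`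
    fset_set (classical_domain K))%fset.
  apply/fsubsetP => z; rewrite !in_fset_set ?inE; last 2 first.
  - exact: classical_domain_finite.
  - exact: classical_domain_finite.
  exact: virtualize_classical_domain.
have /fsetP/(_ (norm_point x)) : fset_set (classical_domain (virtualize K E))
    = fset_set (classical_domain K).
  by apply/eqP; rewrite eqEfcard sub.
rewrite !in_fset_set; last 2 first.
- exact: classical_domain_finite.
- exact: classical_domain_finite.
have Kx : classical_domain K (norm_point x).
  split; first exact: norm_point_range.
  apply: classical_point_periodic (norm_point_same x) _.
  exact: over_classicall xy.
rewrite [RHS]mem_set // => /set_mem[_].
move=> /(classical_point_periodic (same_point_sym (norm_point_same x))).
move=> [z /(classical_crossing_virtualize _ _ KE)[xz Exz]].
suff /(labelling_same KE) -> : same_point y z by [].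
apply: crossing_unique (classical_crossing_crossing xz).
by apply: classical_crossing_crossing; left.
Qed.

End Diagrams.

(** * Orientable atoms and source-sink structures *)

Section Orientability.
Local Open Scope classical_set_scope.
Local Open Scope ring_scope.
Context {R : realType} {n : nat}.
Local Notation point := (@point R n).
Local Notation diagram := (diagram R n).
Implicit Types (K : diagram) (x y z : point) (E : point -> bool) (s t : R).

Lemma seq_min (l : seq R) : l != [::] ->
  exists2 m, m \in l & forall u, u \in l -> m <= u.
Proof.
elim: l => // x [|y l] IHl _; first by exists x; rewrite ?mem_head // => u; rewrite inE => /eqP ->.
have [m ml mP] := IHl isT; exists (Num.min x m).
  by rewrite inE; case: leP => _; rewrite ?eqxx ?ml ?orbT.
by move=> u; rewrite inE => /predU1P[->|/mP mu]; rewrite ge_min ?lexx ?mu ?orbT.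
Qed.

Lemma classical_itv_seq K i s : exists l : seq R, forall u, s <= u <= s + 1 ->
  (classical_point K (i, u) <-> u \in l).
Proof.
set f := fun (k : int) (x : 'I_n * R) => x.2 + k%:~R.
set k := Num.floor s.
pose A := [set u | s <= u <= s + 1 /\ classical_point K (i, u)].
have : finite_set A.
  (* Since [k] is the floor of [s], the interval [[s, s + 1]] lies in [[k, k + 2[], hence in two
     integer translates of the fundamental domain. *)
  apply: (@sub_finite_set _ _ (f k @` classical_domain K `|` f (k + 1) @` classical_domain K)); last first.
    by rewrite finite_setU; split; apply: finite_image; exact: classical_domain_finite.
  move=> u [/andP[su us] Ku].
  have Kn : classical_domain K (norm_point (i, u)).
    split; first exact: norm_point_range.
    exact: classical_point_periodic (norm_point_same (i, u)) Ku.
  have /andP[fs sf] := Num.Theory.floor_itv s; have /andP[fu uf] := Num.Theory.floor_itv u.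
  have k1 : (k <= Num.floor u) by rewrite Num.Theory.floor_ge_int (le_trans fs).
  have k2 : (Num.floor u <= k + 1).
    rewrite -ltzD1 -(ltr_int R) (le_lt_trans fu) //; rewrite intrD in sf.
    by rewrite !intrD; lra.
  have [ku|ku] := eqVneq (Num.floor u) k.
    left; exists (norm_point (i, u)) => //.
    by rewrite /f /norm_point /circle_lift /= subr0 ku subrK.
  right; exists (norm_point (i, u)) => //.
  have -> : k + 1 = Num.floor u.
    by apply/le_anti; rewrite k2 andbT lezD1 lt_neqAle eq_sym ku.
  by rewrite /f /norm_point /circle_lift /= subr0 subrK.
move=> /finite_seqP[l lA]; exists l => u su; split=> [Ku|ul].
  by have : A u by []; rewrite lA.
by have : [set` l] u by []; rewrite -lA => -[].
Qed.

Lemma next_classical_ge K i s : (exists t, classical_point K (i, t)) ->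
  exists p, [/\ s <= p, classical_point K (i, p) &
    forall u, s <= u < p -> ~ classical_point K (i, u)].
Proof.
move=> [t Kt]; have [l lP] := classical_itv_seq K i s.
have /andP[st ts] := lift_itv s t.
have Kl := classical_point_periodic (lift_same s i t) Kt.
have [|m] := @seq_min [seq u <- l | s <= u <= s + 1].
  apply/eqP => /(congr1 (fun l => circle_lift s t \in l)).
  by rewrite mem_filter st (ltW ts) /= (proj1 (lP _ _) Kl) // st ltW.
rewrite mem_filter => /andP[/andP[sm ms] ml] mP; exists m; split=> //.
  by apply/lP; rewrite ?sm.
move=> u /andP[su um] Ku; suff : m <= u by rewrite leNgt um.
have su1 : s <= u <= s + 1 by rewrite su (le_trans (ltW um)).
by apply: mP; rewrite mem_filter su1; apply/lP.
Qed.

Lemma no_classical_right K i s :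
  exists2 m, s < m & forall u, s < u < m -> ~ classical_point K (i, u).
Proof.
have [l lP] := classical_itv_seq K i s.
have [|m] := @seq_min (s + 1 :: [seq u <- l | s < u]); first by [].
move=> ml mP; have m1 : m <= s + 1 by apply: mP; rewrite mem_head.
exists m.
  move: ml; rewrite inE mem_filter => /predU1P[->|/andP[]//]; first by rewrite ltrDl.
move=> u /andP[su um] Ku; suff : m <= u by rewrite leNgt um.
apply: mP; rewrite inE mem_filter su; apply/orP; right; apply/lP => //.
by rewrite !ltW // (lt_le_trans um).
Qed.

Lemma no_classical_left K i s :
  exists2 m, m < s & forall u, m < u < s -> ~ classical_point K (i, u).
Proof.
have [l lP] := classical_itv_seq K i (s - 1).
have [|m] := @seq_min (1 - s :: [seq - u | u <- l & u < s]); first by [].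
move=> ml mP; have m1 : m <= 1 - s by apply: mP; rewrite mem_head.
exists (- m).
  move: ml; rewrite inE => /predU1P[->|/mapP[u]]; first lra.
  by rewrite mem_filter => /andP[us _] ->; rewrite opprK.
move=> u /andP[mu us] Ku; suff : m <= - u by lra.
apply: mP; rewrite inE map_f ?orbT // mem_filter us; apply/lP => //.
by apply/andP; split; lra.
Qed.

Lemma next_classical_gt K i s : (exists t, classical_point K (i, t)) ->
  exists p, [/\ s < p, classical_point K (i, p) &
    forall u, s < u < p -> ~ classical_point K (i, u)].
Proof.
move=> iK; have [m sm mP] := no_classical_right K i s.
have [p [mp Kp pP]] := next_classical_ge ((s + m) / 2) iK.
exists p; split=> //; first lra.
move=> u /andP[su up]; have [um|mu] := ltP u m; first by apply: mP; rewrite su.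
by apply: pP; apply/andP; split; lra.
Qed.

Lemma edge_label K E i s t : labels K E -> s < t -> classical_point K (i, s) ->
  (forall u, s < u < t -> ~ classical_point K (i, u)) -> E (i, t) = ~~ E (i, s).
Proof.
move=> KE st Ks noK.
apply: (@locally_constant_eq _ _ (fun u => E (i, u)) _ s t) => //.
- have [_ Er] := (KE i).2 s; near=> u; rewrite -addbT.
  by rewrite -(asboolT Ks); near: u.
- by move=> u _; exact: ((KE i).2 u).1.
move=> u /noK Ku; have [_ Er] := (KE i).2 u.
by near=> w; rewrite -[RHS]addbF -(asboolF Ku); near: w.
Unshelve. all: by end_near. Qed.

Section SourceSink.
Variables (K : diagram) (o : half_edge K * bool -> bool).
Hypothesis oP : forall (k : 'I_3) (t t' : triangle (atom K)), adj k t t' -> o t' = ~~ o t.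
Implicit Types h : half_edge K.

Lemma orientation_color h : o (h, false) = ~~ o (h, true).
Proof. exact: (@oP (@Ordinal 3 2 isT) (h, true) (h, false) (conj erefl isT)). Qed.

Lemma tangent_det h h' : crossing K (he_point h) (he_point h') ->
  det (he_tangent h) (he_tangent h') != 0.
Proof.
have detNl (u v : R * R) : det (- u) v = - det u v by rewrite /det /= !mulNr -opprD.
have detNr (u v : R * R) : det u (- v) = - det u v by rewrite /det /= !mulrN -opprD.
move=> [hh' e]; have := curve_transverse e hh'; rewrite /he_tangent -/(velocity K _).
by case: (he_forward h); case: (he_forward h'); rewrite ?detNl ?detNr ?oppr_eq0.
Qed.

(** An overpassing and an underpassing half-edge bound an A-angle or a B-angle according to the sign
    of the determinant. In the second case the gluing is between white triangles, and passing to
    black ones negates both sides. *)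
Lemma orientation_angle h h' : over K (he_point h) (he_point h') ->
  o (h', true) = ~~ o (h, true).
Proof.
move=> hh'.
have : det (he_tangent h) (he_tangent h') != 0.
  by apply: tangent_det; apply: classical_crossing_crossing; left.
rewrite neq_lt => /orP[lt0|gt0].
  have : o (h', false) = ~~ o (h, false).
    by apply: (@oP (@Ordinal 3 1 isT) (h, false) (h', false)); split=> //; left.
  by rewrite !orientation_color => /negb_inj.
by apply: (@oP (@Ordinal 3 1 isT) (h, true) (h', true)); split=> //; left.
Qed.

(** The two opposite half-edges of a branch are both adjacent to a half-edge [g] of the other
    branch, so both have the value opposite to that of [g]. *)
Lemma orientation_point h h' : he_point h = he_point h' -> o (h, true) = o (h', true).
Proof.
move=> hh'; have [y hy] := he_classical h.
have Ky : classical_point K (norm_point y).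
  apply: classical_point_periodic (norm_point_same y) _.
  by exists (he_point h); case: hy; [right|left].
pose g := @HalfEdge R n K (norm_point y) true Ky (norm_point_range y).
have yn := same_point_sym (norm_point_same y).
case: hy => hy.
  have hg : over K (he_point h) (he_point g).
    by apply/(over_same K (same_point_refl _) yn).
  apply: negb_inj; rewrite -(orientation_angle hg).
  by rewrite hh' in hg; rewrite -(orientation_angle hg).
have hg : over K (he_point g) (he_point h).
  by apply/(over_same K yn (same_point_refl _)).
rewrite (orientation_angle hg).
by rewrite hh' in hg; rewrite (orientation_angle hg).
Qed.

(** This bit plays the part of incoming against outgoing, common to the two half-edges of a branch.
    No half-edge sits at a point that is not classical, where the value is therefore [false]. *)
Let sigma x : bool := `[< exists h, he_point h = norm_point x /\ o (h, true) >].

Lemma sigmaE h x : he_point h = norm_point x -> sigma x = o (h, true).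
Proof.
move=> hx; apply/asboolP/idP => [[h' [h'x oh']]|oh]; last by exists h.
by rewrite (@orientation_point h h') // hx.
Qed.

Let half_edge_at x b (Kx : classical_point K x) : half_edge K :=
  HalfEdge b (classical_point_periodic (norm_point_same x) Kx) (norm_point_range x).

Lemma sigma_over x y : over K x y -> sigma x != sigma y.
Proof.
move=> xy; have Kx := over_classicall xy; have Ky := over_classicalr xy.
rewrite (@sigmaE (half_edge_at true Kx) x) // (@sigmaE (half_edge_at true Ky) y) //.
rewrite (@orientation_angle (half_edge_at true Kx) (half_edge_at true Ky)).
  by rewrite eq_sym -eqbF_neg; case: (o _).
by apply/(over_same K (norm_point_same x) (norm_point_same y)).
Qed.

Lemma sigma_edge i s t : s < t -> classical_point K (i, s) -> classical_point K (i, t) ->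
  (forall u, s < u < t -> ~ classical_point K (i, u)) -> sigma (i, t) = ~~ sigma (i, s).
Proof.
move=> st Ks Kt noK.
rewrite (@sigmaE (half_edge_at true Ks) (i, s)) // (@sigmaE (half_edge_at false Kt) (i, t)) //.
apply: (@oP (@Ordinal 3 0 isT) (half_edge_at true Ks, true) (half_edge_at false Kt, true)).
split=> //; left; split=> //; rewrite /= /circle_lift !subr0.
(* Half-edges live at representatives in [[0, 1[]; this shift restores the distance [t - s] between
   the two ends. *)
exists (Num.floor t - Num.floor s); first by rewrite intrB; lra.
move=> u; rewrite intrB => /andP[su ut] Ku.
apply: (noK (u + (Num.floor s)%:~R)); first by apply/andP; split; lra.
apply: classical_point_periodic Ku.
by apply: same_point_sym; exact: same_point_shift.
Qed.

Lemma source_sink_orientation : exists2 E, labels K E & source_sink K E.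
Proof.
pose nxt i s p := [/\ s <= p, classical_point K (i, p) &
    forall u, s <= u < p -> ~ classical_point K (i, u)].
have nxt_uniq i s p q : nxt i s p -> nxt i s q -> p = q.
  move=> [sp Kp noKp] [sq Kq noKq]; apply/eqP; rewrite eq_le !leNgt.
  by apply/andP; split; apply/negP => pq; [apply: (noKp q)|apply: (noKq p)] => //; apply/andP.
(* The label of an edge is read at the first classical point at or after [x], that is, where the
   edge ends. A circle without classical points gets the label [false]. *)
pose E x := `[< exists p, nxt x.1 x.2 p /\ sigma (x.1, p) >].
have Enxt i s p : nxt i s p -> E (i, s) = sigma (i, p).
  move=> isp; apply/asboolP/idP => /= [[q [isq]]|sp]; last by exists p.
  by rewrite (nxt_uniq _ _ _ _ isp isq).
have Enone i s : ~ (exists t, classical_point K (i, t)) -> E (i, s) = false.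
  by move=> iK; apply/asboolPn => -[p [[_ Kp _] _]]; apply: iK; exists p.
have Ecl x : classical_point K x -> E x = sigma x.
  by case: x => i s Ks; apply: Enxt; split=> // u; rewrite leNgt andNb.
have shift1 i t : same_point ((i, t) : point) (i, t + 1).
  by split=> //; exists 1.
exists E; last by move=> x y xy; rewrite !Ecl ?sigma_over //; [exact: over_classicalr xy|exact: over_classicall xy].
move=> i; have [iK|iK] := pselect (exists t, classical_point K (i, t)); last first.
  split=> [t|s]; first by rewrite !Enone.
  split; first by near=> t; rewrite !Enone.
  near=> t; rewrite !Enone // asboolF // => Ks.
  by apply: iK; exists s.
split=> [t|s].
  have [p [tp Kp noK]] := next_classical_ge t iK.
  rewrite (Enxt i t p) // (Enxt i (t + 1) (p + 1)).
    by rewrite /sigma (norm_point_eq (shift1 i p)).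
  split; first by rewrite lerD2r.
    exact: classical_point_periodic (shift1 i p) Kp.
  move=> u tup Ku; apply: (noK (u - 1)); first by apply/andP; split; lra.
  by apply: classical_point_periodic Ku; apply: same_point_sym; rewrite -{2}(subrK 1 u).
split.
  have [m ms mP] := no_classical_left K i s.
  have [p [sp Kp noK]] := next_classical_ge s iK.
  apply/near_leftP; exists m => // t /andP[mt ts].
  rewrite !(Enxt _ _ p) //; split=> //; first by rewrite ltW // (lt_le_trans ts).
  move=> u /andP[tu up]; have [us|su] := ltP u s; last by apply: noK; rewrite su.
  by apply: mP; rewrite us (lt_le_trans mt).
have [p [sp Kp noK]] := next_classical_gt s iK.
apply/near_rightP; exists p => // t /andP[st tp].
rewrite (Enxt i t p); last first.
  by split=> // [|u /andP[tu up]]; [exact: ltW|apply: noK; rewrite up (lt_le_trans st)].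
have [Ks|Ks] := pselect (classical_point K (i, s)).
  by rewrite asboolT // addbT Ecl //; apply: sigma_edge.
rewrite asboolF // addbF (Enxt i s p) //; split=> // [|u /andP[]]; first exact: ltW.
rewrite le_eqVlt => /predU1P[<-//|su up].
by apply: noK; rewrite su.
Unshelve. all: by end_near. Qed.

End SourceSink.

Lemma orientable_atomP K :
  has_orientable_atom K <-> exists2 E, labels K E & source_sink K E.
Proof.
split=> [[f fP]|[E KE ss]]; first exact: (source_sink_orientation fP).
have E_edge (h h' : half_edge K) : edge_forward h h' -> E (he_point h') = ~~ E (he_point h).
  have := he_classical h; rewrite /edge_forward.
  case: (he_point h) (he_point h') => [i s] [j t] /= Ks [_ _ /= <- [k st noK]].
  rewrite -(edge_label KE st Ks noK).
  by apply: (labelling_same KE); apply: same_point_sym; exact: same_point_shift.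
have E_over (h h' : half_edge K) : over K (he_point h) (he_point h') ->
    E (he_point h') = ~~ E (he_point h).
  by move=> /ss; case: (E _); case: (E _).
(* Crossing the side opposite to corner 0 or 1 flips [E] and keeps the colour; crossing the side
   opposite to corner 2 flips only the colour. *)
exists (fun p => E (he_point p.1) (+) p.2).
move=> [[|[|[|m]]] m3] [h c] [h' c'] //= [].
- by move=> -> [] /E_edge ->; rewrite addNb ?negbK.
- by move=> ->; rewrite /angle; case: c' => -[] [/E_over -> _]; rewrite addNb ?negbK.
- by move=> ->; rewrite -addbN; case: c; case: c'.
Qed.

End Orientability.

(** * Planar isotopies *)

Section Isotopies.
Local Open Scope classical_set_scope.
Local Open Scope ring_scope.
Context {R : realType} {n : nat}.
Local Notation point := (@point R n).
Local Notation diagram := (diagram R n).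
Implicit Types (K : diagram) (x y z : point) (E : point -> bool) (r : R -> R).

Lemma increasing_reflect (f g : R -> R) : cancel g f ->
  {homo f : s t / s < t} -> {homo g : s t / s < t}.
Proof.
move=> gK f_inc s t st; rewrite ltNge le_eqVlt; apply/negP => /predU1P[e|/f_inc].
  by move: st; rewrite -(gK s) -(gK t) e ltxx.
by rewrite !gK => /(lt_trans st); rewrite ltxx.
Qed.

Lemma circle_homeo_increasing_inv r : continuous r -> {homo r : s t / s < t} ->
  (forall t, r (t + 1) = r t + 1) ->
  exists r', [/\ continuous r', {homo r' : s t / s < t},
    forall t, r' (t + 1) = r' t + 1, cancel r r' & cancel r' r].
Proof.
move=> r_cont r_inc r1.
have rN (m : nat) t : r (t + m%:R) = r t + m%:R.
  elim: m => [|m IHm]; first by rewrite !addr0.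
  by rewrite -[m.+1]addn1 natrD !addrA r1 IHm.
have rZ (k : int) (t : R) : r (t + k%:~R) = r t + k%:~R.
  case: k => m; first by rewrite -[Posz m]/(m%:Z) -pmulrn rN.
  by rewrite NegzE mulrNz -pmulrn -[in RHS](subrK (m.+1)%:R t) rN addrK.
have r_surj (y : R) : exists t, r t = y.
  (* With this [k], [r k = r 0 + k] and [r (k + 1) = r 0 + k + 1] enclose [y], so the intermediate
     value theorem applies on a period. *)
  set k := Num.floor (y - r 0).
  have /andP[ky yk] := Num.Theory.floor_itv (y - r 0).
  have rk : r k%:~R = r 0 + k%:~R by rewrite -[X in r X]add0r rZ.
  have [|||c _ <-] := @IVT R r k%:~R (k%:~R + 1) y.
  - by rewrite lerDl.
  - exact: continuous_subspaceT.
  - rewrite r1 rk; rewrite intrD -/k in yk; rewrite -/k in ky.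
    by rewrite ge_min le_max; apply/andP; split; apply/orP; [left|right]; lra.
  - by exists c.
have [r' r'K] := choice r_surj.
have r'_inc := increasing_reflect r'K r_inc.
have rK : cancel r r'.
  move=> t; case: (ltgtP (r' (r t)) t) => // /r_inc; rewrite r'K ltxx //.
exists r'; split=> //.
- move=> t; rewrite -(r'K t).
  apply: (@nbhs_singleton _ _ [set u | {for u, continuous r'}]).
  by apply: near_can_continuous; near=> u.
- by move=> t; apply: (can_inj rK); rewrite r1 !r'K.
Unshelve. all: by end_near. Qed.

Lemma circle_homeo_inv r : circle_homeo r ->
  exists r', [/\ circle_homeo r', cancel r r', cancel r' r &
    {homo r : s t / s < t} -> {homo r' : s t / s < t}].
Proof.
move=> [r_cont [[r_inc r1]|[r_dec r1]]].
  have [r' [r'_cont r'_inc r'1 rK r'K]] := circle_homeo_increasing_inv r_cont r_inc r1.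
  by exists r'; split=> //; split=> //; left.
have [|||r' [r'_cont r'_inc r'1 rK r'K]] := @circle_homeo_increasing_inv (fun t => - r t).
- by move=> t; apply: continuousN; exact: r_cont.
- by move=> s t /r_dec; rewrite ltrN2.
- by move=> t; rewrite r1 opprB addrC.
exists (fun t => r' (- t)).
have r'r t : r (r' (- t)) = t by apply: oppr_inj; rewrite r'K.
have rr' t : r' (- r t) = t := rK t.
split=> //; last first.
  by move=> r_inc; have := r_dec _ _ ltr01; rewrite ltNge ltW // r_inc.
split; last right.
  by move=> t; apply: continuous_comp; [exact: opp_continuous|exact: r'_cont].
split; first by move=> s t st; apply: r'_inc; rewrite ltrN2.
move=> t; rewrite opprD; apply: (addIr 1).
by rewrite -r'1 !subrK.
Qed.

(** The permutation of components is made a parameter, since a function of the components has to be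
    carried along it. *)
Definition isotopic_by (s : {perm 'I_n}) K K' : Prop :=
  exists (H : R * (R * R) -> R * R) (r : 'I_n -> R -> R),
    let f x : point := (s x.1, r x.1 x.2) in
    [/\ ambient_isotopy H,
        forall i, circle_homeo (r i),
        forall x, pos K' (f x) = H (1, pos K x) &
        forall x y, over K x y <-> over K' (f x) (f y)].

Lemma isotopic_by_sym s K K' : isotopic_by s K K' -> isotopic_by s^-1 K' K.
Proof.
move=> [H [r [[H_cont H0 H_homeo] rh posH overH]]].
have [r' r'P] := choice (fun i => circle_homeo_inv (rh i)).
have [H1_cont [g [g_cont gK Kg]]] := H_homeo 1.
pose f x : point := (s x.1, r x.1 x.2).
pose f' x : point := ((s^-1)%g x.1, r' ((s^-1)%g x.1) x.2).
have f'K x : f (f' x) = x.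
  by case: x => i t; rewrite /f /f' /= permKV; have [_ _ -> _] := r'P ((s^-1)%g i).
(* Run the isotopy backwards after applying the inverse [g] of its final map: it starts at the
   identity and ends at [g]. Inverting each stage instead would require the inverses to be jointly
   continuous. *)
exists (fun p => H (1 - p.1, g p.2)), (fun i => r' ((s^-1)%g i)); split.
- split.
  + move=> p.
    apply: (@continuous2_cvg _ _ _ _ (nbhs p) _ (fun q => 1 - q.1) (fun q => g q.2)
      (fun t q => H (t, q))).
    * have -> : (fun z : R * (R * R) => H (z.1, z.2)) = H by apply/funext => -[].
      exact: H_cont.
    * by apply: cvgB; [exact: cvg_cst|exact: cvg_fst].
    * exact: continuous_comp (@cvg_snd _ _ _ _ _) (g_cont p.2).
  + by move=> p; rewrite subr0 Kg.
  + move=> t; have [Ht_cont [h [h_cont hK Kh]]] := H_homeo (1 - t); split.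
      by move=> p; exact: (continuous_comp (g_cont p) (Ht_cont (g p))).
    exists (fun p => H (1, h p)); split.
    * by move=> p; exact: (continuous_comp (h_cont p) (H1_cont (h p))).
    * by move=> p /=; rewrite hK Kg.
    * by move=> p /=; rewrite gK Kh.
- by move=> i; have [] := r'P ((s^-1)%g i).
- by move=> x; rewrite -[in RHS](f'K x) posH /= subrr H0 gK.
- by move=> x y; rewrite -{1}(f'K x) -{1}(f'K y) -overH.
Qed.

Definition twist E (c : 'I_n -> bool) x : bool := E x (+) c x.1.

Lemma labels_twist K E c : labels K E -> labels K (twist E c).
Proof. exact: labelling_addb. Qed.

(** The isotopy preserves the labels at classical points, which are all that virtualization
    consults. The labelling of [K'] is chosen before [c], so that all twists of one labelling are
    carried simultaneously. *)
Lemma isotopic_by_labels s K K' E : isotopic_by s K K' -> labels K E ->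
  exists2 E', labels K' E' & forall c, isotopic_by s (virtualize K (twist E c))
    (virtualize K' (twist E' (fun i => c ((s^-1)%g i)))).
Proof.
move=> [H [r [Hiso rh posH overH]]] KE.
have [r' r'P] := choice (fun i => circle_homeo_inv (rh i)).
pose f x : point := (s x.1, r x.1 x.2).
pose f' x : point := ((s^-1)%g x.1, r' ((s^-1)%g x.1) x.2).
have f'K x : f (f' x) = x.
  by case: x => i t; rewrite /f /f' /= permKV; have [_ _ -> _] := r'P ((s^-1)%g i).
have fK x : f' (f x) = x.
  by case: x => i t; rewrite /f /f' /= permK; have [_ -> _ _] := r'P i.
have classicalf x : classical_point K x <-> classical_point K' (f x).
  split=> [[y [xy|xy]]|[y [xy|xy]]].
  - by exists (f y); left; apply/overH.
  - by exists (f y); right; apply/overH.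
  - by exists (f' y); left; apply/overH; rewrite -/(f _) -/(f _) f'K.
  - by exists (f' y); right; apply/overH; rewrite -/(f _) -/(f _) f'K.
have classicalf' x : `[< classical_point K' x >] = `[< classical_point K (f' x) >].
  by rewrite -{1}(f'K x); apply: asbool_equiv_eq; apply: iff_sym.
pose dec i := ~~ `[< {homo r i : s t / s < t} >].
(* A reversed component is traversed the other way: the edge before a point
   becomes the edge after it, and its orientation relative to the parameter
   changes. At classical points the two changes cancel. *)
pose E0 x := E x (+) (dec x.1 && ~~ `[< classical_point K x >]).
pose E' x := E0 (f' x).
have E'f x : classical_point K x -> E' (f x) = E x.
  by move=> Kx; rewrite /E' fK /E0 asboolT // andbF addbF.
have KE' : labels K' E'.
  move=> j; set i := (s^-1)%g j.
  have [[_ r'h] rK r'K r'_inc] := r'P i; rewrite -/i in r'_inc.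
  have [iinc|idec] := boolP `[< {homo r i : s t / s < t} >].
    have E'E t : E' (j, t) = E (i, r' i t) by rewrite /E' /E0 /dec iinc addbF.
    have {}r'_inc := r'_inc (asboolW iinc).
    have r'1 t : r' i (t + 1) = r' i t + 1.
      case: r'h => -[h ->] //.
      by have := h _ _ ltr01; rewrite ltNge ltW // r'_inc.
    split=> [t|t]; first by rewrite !E'E r'1 (KE i).1.
    have [/near_leftP[m mt mP] /near_rightP[w tw wP]] := (KE i).2 (r' i t).
    split.
      apply/near_leftP; exists (r i m).
        by rewrite -(r'K t); exact: (asboolW iinc).
      move=> u /andP[mu ut]; rewrite !E'E; apply: mP.
      by rewrite -(rK m) !r'_inc.
    apply/near_rightP; exists (r i w).
      by rewrite -(r'K t); exact: (asboolW iinc).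
    move=> u /andP[tu uw]; rewrite !E'E classicalf'; apply: wP.
    by rewrite -(rK w) !r'_inc.
  have r_dec : {homo r i : s t / s < t >-> t < s}.
    by have [_ [[r_inc _]|[]//]] := rh i; case/asboolP: idec.
  have [r'_dec r'1] : {homo r' i : s t / s < t >-> t < s} /\ forall t, r' i (t + 1) = r' i t - 1.
    case: r'h => // -[h _]; exfalso.
    have := h _ _ (r_dec _ _ ltr01); rewrite !rK ltNge ltW //; exact: ltr01.
  have E'E t : E' (j, t) = E (i, r' i t) (+) ~~ `[< classical_point K (i, r' i t) >].
    by rewrite /E' /E0 /dec -/i idec.
  have shift t : same_point ((i, r' i (t + 1)) : point) (i, r' i t).
    by split=> //; exists 1; rewrite /= r'1 subrK.
  split=> [t|t].
    rewrite !E'E; congr (_ (+) ~~ _); first exact: (labelling_same KE).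
    apply: asbool_equiv_eq; split; apply: classical_point_periodic => //.
    exact: same_point_sym.
  have [/near_leftP[m mt mP] /near_rightP[w tw wP]] := (KE i).2 (r' i t).
  (* On a reversed component [E0] is negated exactly off the classical points, so one-sided
     neighbourhoods free of classical points are needed as well, and left and right are
     exchanged. *)
  have [m' m't m'P] := no_classical_left K i (r' i t).
  have [w' tw' w'P] := no_classical_right K i (r' i t).
  split.
    apply/near_leftP; exists (r i (Num.min w w')).
      by rewrite -(r'K t); apply: r_dec; rewrite lt_min tw tw'.
    move=> u /andP[mu ut]; have := r'_dec _ _ mu; rewrite rK lt_min => /andP[uw uw'].
    have tu := r'_dec _ _ ut.
    have Ku : `[< classical_point K (i, r' i u) >] = false.
      by apply: asboolF; apply: w'P; rewrite tu.
    by rewrite !E'E wP ?tu // Ku addbT addbN.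
  apply/near_rightP; exists (r i (Num.max m m')).
    by rewrite -(r'K t); apply: r_dec; rewrite gt_max mt m't.
  move=> u /andP[tu um]; have := r'_dec _ _ um; rewrite rK gt_max => /andP[mu mu'].
  have ut := r'_dec _ _ tu.
  have Ku : `[< classical_point K (i, r' i u) >] = false.
    by apply: asboolF; apply: m'P; rewrite ut andbT.
  by rewrite !E'E mP ?ut ?andbT // Ku classicalf' /f' /= -/i addbT addbN addNb addbK.
exists E' => // c; exists H, r; split=> // x y.
rewrite !over_virtualize; try exact: labels_twist.
split=> -[xy Exy].
  split; first by apply/overH.
  rewrite /twist -/(f x) -/(f y) !E'f /= ?permK //.
    exact: over_classicalr xy.
  exact: over_classicall xy.
have {}xy : over K x y by apply/overH.
split=> //; move: Exy; rewrite /twist -/(f x) -/(f y) !E'f /= ?permK //.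
  exact: over_classicalr xy.
exact: over_classicall xy.
Qed.

End Isotopies.

(** * Reidemeister moves *)

Section Moves.
Local Open Scope classical_set_scope.
Local Open Scope ring_scope.
Context {R : realType} {n : nat}.
Local Notation point := (@point R n).
Local Notation diagram := (diagram R n).
Local Notation arc := (@arc R n).
Implicit Types (K X Y : diagram) (x y z : point) (E : point -> bool) (a b c d : arc).
Implicit Types (C O : set point) (u v : R).

Lemma in_oarcW a u : in_oarc a u -> in_carc a u.
Proof. by move=> /andP[bu ue]; apply/andP; split; exact: ltW. Qed.

Lemma oarc_carc a x : oarc a x -> carc a x.
Proof. by move=> [u /in_oarcW ? ?]; exists u. Qed.

Lemma pt_oarc a u : in_oarc a u -> oarc a (pt a u).
Proof. by move=> au; exists u => //; exact: same_point_refl. Qed.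

Lemma pt_carc a u : in_carc a u -> carc a (pt a u).
Proof. by move=> au; exists u => //; exact: same_point_refl. Qed.

Lemma arc_begin_carc a : carc a (pt a (arc_begin a)).
Proof. by apply: pt_carc; apply/andP; split=> //; apply/ltW/arc_lt. Qed.

Lemma arc_begin_oarc a : ~ oarc a (pt a (arc_begin a)).
Proof.
move=> /oarc_lift[_ /=].
have -> : circle_lift (arc_begin a) (arc_begin a) = arc_begin a.
  by apply: (lift_eq _ (same_point_refl (arc_comp a, arc_begin a))); rewrite lexx ltrDl ltr01.
by rewrite /in_oarc ltxx.
Qed.

Lemma oarc_same a x y : same_point x y -> oarc a x -> oarc a y.
Proof.
move=> xy [u au xu]; exists u => //.
exact: same_point_trans (same_point_sym xy) xu.
Qed.

Lemma disjoint_arcs a b x : carc a `&` carc b = set0 -> carc a x -> ~ carc b x.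
Proof. by move=> ab ax bx; have : (carc a `&` carc b) x by []; rewrite ab. Qed.

Lemma crossing_same K x x' y y' : same_point x x' -> same_point y y' ->
  crossing K x y -> crossing K x' y'.
Proof.
move=> xx yy [xy e]; split; last by rewrite -(pos_same K xx) -(pos_same K yy).
move=> xy'; apply: xy; apply: same_point_trans xx _.
exact: same_point_trans xy' (same_point_sym yy).
Qed.

Lemma meet_once_sym K a b u v : meet_once K a b u v -> meet_once K b a v u.
Proof.
move=> [au bv uv uvP]; split=> //; first exact: crossing_sym.
by move=> v' u' bv' au' /crossing_sym/(uvP _ _ au' bv')[].
Qed.

Lemma agree_off_sym X Y a : agree_off X Y a -> agree_off Y X a.
Proof.
move=> [XYpos XYover XYends]; split.
- by move=> x xa; rewrite XYpos.
- by move=> x y xa ya; rewrite XYover.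
- by move=> y; have [] := XYends y.
Qed.

Lemma agree_off_virtualize X Y E E' a : agree_off X Y a -> labels X E -> labels Y E' ->
  (forall x y, ~ oarc a x -> ~ oarc a y -> over X x y -> (E x != E y) = (E' x != E' y)) ->
  agree_off (virtualize X E) (virtualize Y E') a.
Proof.
move=> [XYpos XYover XYends] XE YE' EE'; split=> // x y xa ya.
rewrite !over_virtualize //; split=> -[xy Exy].
  by rewrite -XYover // -EE'.
by rewrite XYover // EE' // XYover.
Qed.

Lemma disk_crossing phi K C O x y : disk_meets phi K C O -> crossing K x y -> O x -> O y.
Proof. by move=> [_ <-] [_ e]; rewrite /preimage /= e. Qed.

(** [O] is the preimage of an open disk, so no crossing joins a point of [O] to a point outside;
    crossings away from the disk are common to both diagrams. *)
Lemma classical_off phi X Y C O a x : agree_off X Y a ->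
  disk_meets phi X C O -> disk_meets phi Y C O -> oarc a `<=` O -> ~ O x ->
  classical_point X x <-> classical_point Y x.
Proof.
suff H X' Y' : agree_off X' Y' a -> disk_meets phi X' C O -> oarc a `<=` O ->
    ~ O x -> classical_point X' x -> classical_point Y' x.
  by move=> XY Xd Yd aO xO; split; apply: H => //; exact: agree_off_sym.
move=> [_ XYover _] X'd aO xO [y xy].
have yO : ~ O y.
  by move=> yO; apply: xO; exact: disk_crossing X'd (crossing_sym (classical_crossing_crossing xy)) yO.
have xa : ~ oarc a x by move=> /aO.
have ya : ~ oarc a y by move=> /aO.
by exists y; case: xy => /(XYover _ _) xy; [left|right]; apply: xy.
Qed.

Lemma marked_ext a (C C' : point -> Prop) l : (forall x, oarc a x -> (C x <-> C' x)) ->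
  marked_points a C l -> marked_points a C' l.
Proof.
by move=> CC' [lu la lC]; split=> // u au; rewrite -lC // -CC' //; exact: pt_oarc.
Qed.

(** Marks changed on a single arc, an intermediate stage that lets [relabel] treat arcs one by one.
    It need not come from a diagram, which is why labellings are defined for arbitrary sets of
    marks. *)
Definition replace_on a (C C' : point -> Prop) x := (oarc a x /\ C' x) \/ (~ oarc a x /\ C x).

Lemma replace_on_periodic a (C C' : point -> Prop) :
  periodic C -> periodic C' -> periodic (replace_on a C C').
Proof.
move=> pC pC' x y xy [[xa Cx]|[xa Cx]]; [left|right]; split.
- exact: oarc_same xy xa.
- exact: pC' xy Cx.
- by move=> /(oarc_same (same_point_sym xy)).
- exact: pC xy Cx.
Qed.

Lemma replace_onE a (C C' : point -> Prop) x : oarc a x -> C' x <-> replace_on a C C' x.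
Proof. by rewrite /replace_on; tauto. Qed.

Lemma replace_offE a (C C' : point -> Prop) x : ~ oarc a x -> C x <-> replace_on a C C' x.
Proof. by rewrite /replace_on; tauto. Qed.

Definition same_parity a (C C' : point -> Prop) := exists l l',
  [/\ marked_points a C l, marked_points a C' l' & odd (size l) = odd (size l')].

Lemma relabel2 (C C' : point -> Prop) E a b : periodic C -> periodic C' ->
  (forall x, oarc a x -> ~ oarc b x) -> same_parity a C C' -> same_parity b C C' ->
  (forall x, ~ oarc a x -> ~ oarc b x -> (C x <-> C' x)) -> labelling C E ->
  exists2 E', labelling C' E' & forall x, ~ oarc a x -> ~ oarc b x -> E x = E' x.
Proof.
move=> pC pC' ab [la [la' [aC aC' ala]]] [lb [lb' [bC bC' blb]]] CC' CE.
have [|x xa|E1 CE1 EE1] := relabel pC (replace_on_periodic (a := a) pC pC') aC _ ala _ CE.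
- by apply: marked_ext aC' => x; exact: replace_onE.
- exact: replace_offE.
have [|x xb|E2 CE2 E12] := relabel (replace_on_periodic (a := a) pC pC') pC' _ bC' blb _ CE1.
- apply: marked_ext bC => x bx; apply: replace_offE => ax.
  exact: ab ax bx.
- have [xa|xa] := pselect (oarc a x); first by rewrite -replace_onE.
  by rewrite -replace_offE // CC'.
by exists E2 => // x xa xb; rewrite EE1 // E12.
Qed.

Lemma relabel3 (C C' : point -> Prop) E a b c : periodic C -> periodic C' ->
  (forall x, oarc a x -> ~ oarc b x) -> (forall x, oarc a x -> ~ oarc c x) ->
  (forall x, oarc b x -> ~ oarc c x) ->
  same_parity a C C' -> same_parity b C C' -> same_parity c C C' ->
  (forall x, ~ (oarc a `|` oarc b `|` oarc c) x -> (C x <-> C' x)) -> labelling C E ->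
  exists2 E', labelling C' E' & forall x, ~ (oarc a `|` oarc b `|` oarc c) x -> E x = E' x.
Proof.
move=> pC pC' ab ac bc [la [la' [aC aC' ala]]] [lb [lb' [bC bC' blb]]]
  [lc [lc' [cC cC' clc]]] CC' CE.
have [|x xa|E1 CE1 EE1] := relabel pC (replace_on_periodic (a := a) pC pC') aC _ ala _ CE.
- by apply: marked_ext aC' => x; exact: replace_onE.
- exact: replace_offE.
have [||x xb xc|E2 CE2 E12] := @relabel2 (replace_on a C C') C' E1 b c
  (replace_on_periodic (a := a) pC pC') pC' bc _ _ _ CE1.
- exists lb, lb'; split=> //; apply: marked_ext bC => x bx; apply: replace_offE => ax.
  exact: ab ax bx.
- exists lc, lc'; split=> //; apply: marked_ext cC => x cx; apply: replace_offE => ax.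
  exact: ac ax cx.
- have [xa|xa] := pselect (oarc a x); first by rewrite -replace_onE.
  by rewrite -replace_offE // CC' // => -[[]|].
by exists E2 => // x /not_orP[/not_orP[xa xb] xc]; rewrite EE1 // E12.
Qed.

Definition agree_outside O E E' := forall x, ~ O x -> E x = E' x.

(** Labels are carried in both directions because a basic move may be used backwards. The last
    clause covers every matching pair of labellings, so it applies to twists of both by the same
    function of the components. *)
Definition transfers X Y O :=
  [/\ forall E, labels X E -> exists2 E', labels Y E' & agree_outside O E E',
      forall E', labels Y E' -> exists2 E, labels X E & agree_outside O E E' &
      forall E E', labels X E -> labels Y E' -> agree_outside O E E' ->
        basic_move (virtualize X E) (virtualize Y E')].

(** Only the open arc needs checking: [agree_off] excludes crossings at its ends. *)
Lemma detourI X Y a : agree_off X Y a ->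
  (forall u, in_oarc a u -> ~ classical_point X (pt a u)) ->
  (forall u, in_oarc a u -> ~ classical_point Y (pt a u)) -> basic_move X Y.
Proof.
move=> XY Xa Ya; apply: Or44; exists a; split=> // x [u au xu].
have [XYpos XYover XYends] := XY.
suff [Xu Yu] : ~ classical_point X (pt a u) /\ ~ classical_point Y (pt a u).
  by split=> /(classical_point_periodic xu).
have [au'|au'] := boolP (arc_begin a < u < arc_end a); first by split; [apply: Xa|apply: Ya].
suff uends : u = arc_begin a \/ u = arc_end a.
  split=> -[y /classical_crossing_crossing uy]; have [Xb Xe Yb Ye] := XYends y;
    by case: uends uy => ->.
move: au au'; rewrite /in_carc !le_eqVlt.
by case/andP=> /predU1P[<-|->] /predU1P[->|->]; [left|left|right|].
Qed.

Lemma detour_transfers X Y : detour X Y -> exists O, transfers X Y O.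
Proof.
move=> [a [XY aP]]; exists (oarc a).
have classicalXY x : classical_point X x <-> classical_point Y x.
  have H X' Y' : agree_off X' Y' a -> (forall x, carc a x -> ~ classical_point X' x) ->
      classical_point X' x -> classical_point Y' x.
    move=> [_ X'Y'over _] X'a [y xy].
    have xa : ~ oarc a x by move=> /oarc_carc/X'a; apply; exists y.
    have ya : ~ oarc a y.
      by move=> /oarc_carc/X'a; apply; exists x; case: xy => xy; [right|left].
    by exists y; case: xy => /(X'Y'over _ _) xy; [left|right]; apply: xy.
  split; apply: H => //; [|exact: agree_off_sym|]; by move=> z /aP[].
split=> [E XE|E' YE'|E E' XE YE' EE'].
- by exists E => //; exact: labelling_ext XE.
- by exists E' => //; apply: labelling_ext YE' => x; apply: iff_sym.
apply: (@detourI _ _ a).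
- by apply: agree_off_virtualize => // x y xa ya _; rewrite !EE'.
- move=> u /in_oarcW/pt_carc/aP[Xu _] [y /classical_crossing_virtualize xy].
  by apply: Xu; exists y; have [] := xy XE.
- move=> u /in_oarcW/pt_carc/aP[_ Yu] [y /classical_crossing_virtualize xy].
  by apply: Yu; exists y; have [] := xy YE'.
Qed.

Lemma same_base X Y E E' O a : agree_outside O E E' ->
  (forall x, ~ O x -> (classical_point X x <-> classical_point Y x)) ->
  ~ O (pt a (arc_begin a)) ->
  E (pt a (arc_begin a)) (+) `[< classical_point X (pt a (arc_begin a)) >] =
  E' (pt a (arc_begin a)) (+) `[< classical_point Y (pt a (arc_begin a)) >].
Proof. by move=> EE' XY aO; rewrite EE' //; congr addb; apply: asbool_equiv_eq; exact: XY. Qed.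

Lemma in_oarc_value a u : in_oarc a u -> arc_begin a < u <= arc_end a.
Proof. by move=> /andP[-> /ltW]. Qed.

Lemma pt_crossing_neq K a u v : crossing K (pt a u) (pt a v) -> u != v.
Proof. by move=> [uv _]; apply/eqP => e; apply: uv; rewrite e; exact: same_point_refl. Qed.

(** From [s] to [t] exactly one classical point, [s] itself, is passed, so the labels at the new
    crossing always differ and the kink stays classical. *)
Lemma reidemeister1_transfers X Y : reidemeister1 X Y -> exists O, transfers X Y O.
Proof.
move=> [phi [a [s [t [phiP XY Xd Yd [Xa [as_ at_ st] cst stP]]]]]]; exists (oarc a).
have aX : marked_points a (classical_point X) [::].
  split=> // u au; split=> // -[y /classical_crossing_crossing uy]; exfalso.
  have [v av yv] := disk_crossing Xd uy (pt_oarc au).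
  exact: Xa (in_oarcW au) (in_oarcW av) (crossing_same (same_point_refl _) yv uy).
have aY : marked_points a (classical_point Y) [:: s; t].
  split=> [|u|u au]; first by rewrite /= inE lt_eqF.
    by rewrite !inE => /orP[]/eqP ->.
  split=> [[y /classical_crossing_crossing uy]|].
    have [v av yv] := disk_crossing Yd uy (pt_oarc au).
    have {}uy := crossing_same (same_point_refl _) yv uy.
    have := pt_crossing_neq uy; rewrite neq_lt => /orP[uv|vu].
      by have [-> _] := stP _ _ (in_oarcW au) (in_oarcW av) uv uy; rewrite mem_head.
    have [_ ->] := stP _ _ (in_oarcW av) (in_oarcW au) vu (crossing_sym uy).
    by rewrite !inE eqxx orbT.
  rewrite !inE => /orP[]/eqP ->; first by exists (pt a t).
  by exists (pt a s); case: cst => ?; [right|left].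
have off x : ~ oarc a x -> (classical_point X x <-> classical_point Y x).
  exact: (classical_off XY Xd Yd).
have pX := @classical_point_periodic _ _ X; have pY := @classical_point_periodic _ _ Y.
split=> [E XE|E' YE'|E E' XE YE' EE'].
- exact: (relabel pX pY aX aY).
- have [//|x xa|E YE EE'] := relabel pY pX aY aX _ _ YE'; first by rewrite off.
  by exists E => // x xa; rewrite EE'.
apply: Or41; exists phi, a, s, t; split=> //.
  by apply: agree_off_virtualize => // x y xa ya _; rewrite !EE'.
split=> //; apply/classical_crossing_virtualize => //; split=> //.
rewrite (arc_value YE' aY (in_oarc_value as_)) (arc_value YE' aY (in_oarc_value at_)).
rewrite /= !ltxx st ltNge (ltW st) /=.
by case: (E' _); case: (`[< _ >]).
Qed.

(** Each of the two arcs gains two classical points, so labels extend; the two new crossings are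
    kept or made virtual together, giving a second move or a detour. *)
Lemma reidemeister2_transfers X Y : reidemeister2 X Y -> exists O, transfers X Y O.
Proof.
move=> [phi [a [b [s1 [s2 [t1 [t2 [[phiP XY ab] [Xd Yd] [Xa Xb Ya Yb] Xab
  [[as1 as2 s12] [bt1 bt2] [c1 c2] c12 levels]]]]]]]]].
set O := oarc a `|` oarc b in Xd Yd; exists O.
have aO : oarc a `<=` O by move=> x; left.
have bO : oarc b `<=` O by move=> x; right.
have disj x : oarc a x -> ~ oarc b x.
  by move=> /oarc_carc ax /oarc_carc bx; exact: disjoint_arcs ab ax bx.
have Xnone x y : O x -> ~ crossing X x y.
  move=> Ox xy; have := disk_crossing Xd xy Ox.
  case: Ox => -[u /in_oarcW au xu] [] [v /in_oarcW av yv];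
    have {}xy := crossing_same xu yv xy.
  - exact: Xa au av xy.
  - exact: Xab au av xy.
  - exact: Xab av au (crossing_sym xy).
  - exact: Xb au av xy.
have aX : marked_points a (classical_point X) [::].
  split=> // u /pt_oarc/aO au; split=> // -[y /classical_crossing_crossing].
  by move=> /Xnone; case.
have bX : marked_points b (classical_point X) [::].
  split=> // u /pt_oarc/bO bu; split=> // -[y /classical_crossing_crossing].
  by move=> /Xnone; case.
have Yab u y : in_oarc a u -> crossing Y (pt a u) y ->
    u = s1 /\ same_point y (pt b t1) \/ u = s2 /\ same_point y (pt b t2).
  move=> au uy; have [] := disk_crossing Yd uy (aO _ (pt_oarc au)) => -[v av yv].
    by have /(Ya _ _ (in_oarcW au) (in_oarcW av)) := crossing_same (same_point_refl _) yv uy.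
  have uv := crossing_same (same_point_refl _) yv uy.
  by have [[-> vt]|[-> vt]] := c12 _ _ (in_oarcW au) (in_oarcW av) uv;
    [left|right]; split=> //; rewrite -vt.
have Yba v x : in_oarc b v -> crossing Y (pt b v) x ->
    v = t1 /\ same_point x (pt a s1) \/ v = t2 /\ same_point x (pt a s2).
  move=> bv vx; have [] := disk_crossing Yd vx (bO _ (pt_oarc bv)) => -[u au xu].
    have uv := crossing_sym (crossing_same (same_point_refl _) xu vx).
    by have [[us ->]|[us ->]] := c12 _ _ (in_oarcW au) (in_oarcW bv) uv;
      [left|right]; split=> //; rewrite -us.
  by have /(Yb _ _ (in_oarcW bv) (in_oarcW au)) := crossing_same (same_point_refl _) xu vx.
have t12 : t1 != t2.
  apply/eqP => t12; rewrite -t12 in c2.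
  have := crossing_unique (crossing_sym c1) (crossing_sym c2).
  move: (as1) (as2) => /andP[? ?] /andP[? ?].
  have ? := arc_short a.
  by move=> /same_point_close s_eq; move: s12; rewrite s_eq ?ltxx //; lra.
have cc1 : classical_crossing Y (pt a s1) (pt b t1) by case: levels => -[]; [left|right].
have cc2 : classical_crossing Y (pt a s2) (pt b t2) by case: levels => -[]; [left|right].
have ccC x y : classical_crossing Y x y -> classical_crossing Y y x.
  by case=> ?; [right|left].
have aY : marked_points a (classical_point Y) [:: s1; s2].
  split=> [|u|u au]; first by rewrite /= inE lt_eqF.
    by rewrite !inE => /orP[]/eqP ->.
  rewrite !inE; split=> [[y /classical_crossing_crossing/(Yab _ _ au)]|].
    by case=> -[-> _]; rewrite eqxx ?orbT.
  by move=> /orP[]/eqP ->; [exists (pt b t1)|exists (pt b t2)].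
have bY : marked_points b (classical_point Y) [:: t1; t2].
  split=> [|v|v bv]; first by rewrite /= inE t12.
    by rewrite !inE => /orP[]/eqP ->.
  rewrite !inE; split=> [[x /classical_crossing_crossing/(Yba _ _ bv)]|].
    by case=> -[-> _]; rewrite eqxx ?orbT.
  by move=> /orP[]/eqP ->; [exists (pt a s1)|exists (pt a s2)]; exact: ccC.
have off x : ~ O x -> (classical_point X x <-> classical_point Y x).
  exact: (classical_off XY Xd Yd).
have pX := @classical_point_periodic _ _ X; have pY := @classical_point_periodic _ _ Y.
split=> [E XE|E' YE'|E E' XE YE' EE'].
- have [||x xa xb|E' YE' EE'] := relabel2 pX pY disj _ _ _ XE.
  + by exists [::], [:: s1; s2].
  + by exists [::], [:: t1; t2].
  + by apply: off => -[].
  by exists E' => // x /not_orP[xa xb]; exact: EE'.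
- have [||x xa xb|E XE EE'] := relabel2 pY pX disj _ _ _ YE'.
  + by exists [:: s1; s2], [::].
  + by exists [:: t1; t2], [::].
  + by apply: iff_sym; apply: off => -[].
  by exists E => // x /not_orP[xa xb]; rewrite EE'.
have agree : agree_off (virtualize X E) (virtualize Y E') a.
  apply: agree_off_virtualize => // x y xa ya xy.
  have xO : ~ O x by move=> Ox; apply: (Xnone _ y Ox); apply: classical_crossing_crossing; left.
  have yO : ~ O y by move=> Oy; apply: (Xnone _ x Oy); apply: classical_crossing_crossing; right.
  by rewrite !EE'.
(* Between the two crossings the label flips once on [a] and once on [b], in whichever order [b]
   meets them, and the two flips cancel. *)
have kept : (E' (pt a s1) != E' (pt b t1)) = (E' (pt a s2) != E' (pt b t2)).
  rewrite (arc_value YE' aY (in_oarc_value as1)) (arc_value YE' aY (in_oarc_value as2)).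
  rewrite (arc_value YE' bY (in_oarc_value bt1)) (arc_value YE' bY (in_oarc_value bt2)).
  move: (_ (+) `[< classical_point Y (pt a _) >]) => p.
  move: (_ (+) `[< classical_point Y (pt b _) >]) => q.
  rewrite /= !ltxx s12 ltNge (ltW s12) /=; move: t12; rewrite neq_lt.
  by move=> /orP[]tt; rewrite tt ltNge (ltW tt); case: p; case: q.
have [k1|k1] := boolP (E' (pt a s1) != E' (pt b t1)); last first.
  apply: (@detourI _ _ a) => // u au [y /classical_crossing_virtualize uy].
    have [/classical_crossing_crossing + _] := uy XE.
    by apply: Xnone; apply: aO; exact: pt_oarc.
  have [/classical_crossing_crossing/(Yab _ _ au) uP] := uy YE'.
  by case: uP => -[-> yt]; rewrite (labelling_same YE' yt) -?kept (negbTE k1).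
have k2 : E' (pt a s2) != E' (pt b t2) by rewrite -kept.
apply: Or42; exists phi, a, b, s1, s2, t1, t2; split=> //; split=> //.
case: levels => -[? ?]; [left|right]; split; apply/over_virtualize => //; split=> //.
  by rewrite eq_sym.
by rewrite eq_sym.
Qed.

(** * The third move *)

Lemma classical_crossing_sym K x y : classical_crossing K x y -> classical_crossing K y x.
Proof. by case=> ?; [right|left]. Qed.

Section OneOfThreeArcs.
Variables (K : diagram) (phi : R * R -> R * R) (a b c : arc) (ab ba ac ca : R) (C O : set point).
Hypotheses (Kdisk : disk_meets phi K C O) (aO : oarc a `<=` O)
  (Oabc : O `<=` oarc a `|` oarc b `|` oarc c) (bc : carc b `&` carc c = set0)
  (Ka : simple_arc K a) (Kab : meet_once K a b ab ba) (Kac : meet_once K a c ac ca).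

Lemma triple_neq : ab != ac.
Proof.
have [_ bb cab _] := Kab; have [_ cc cac _] := Kac.
apply/eqP => e; rewrite -e in cac.
apply: (@disjoint_arcs _ _ (pt b ba) bc); first exact/pt_carc/in_oarcW.
exists ca; first exact: in_oarcW.
exact: crossing_unique cab cac.
Qed.

Lemma triple_crossing u y : in_oarc a u -> crossing K (pt a u) y ->
  u = ab /\ same_point y (pt b ba) \/ u = ac /\ same_point y (pt c ca).
Proof.
move=> au uy; have uc := in_oarcW au.
have [_ _ _ abP] := Kab; have [_ _ _ acP] := Kac.
have [[]|] := Oabc (disk_crossing Kdisk uy (aO (pt_oarc au))) => -[v /in_oarcW av yv];
  have uv := crossing_same (same_point_refl _) yv uy.
- by case: (Ka uc av uv).
- by left; have [-> <-] := abP _ _ uc av uv.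
- by right; have [-> <-] := acP _ _ uc av uv.
Qed.

Definition pick_if (P : Prop) u : seq R := if `[< P >] then [:: u] else [::].

Lemma mem_pick_if (P : Prop) u v : v \in pick_if P u <-> P /\ v = u.
Proof.
rewrite /pick_if; case: asboolP => p; last by split=> // -[].
by rewrite inE; split=> [/eqP|[_ ->]].
Qed.

Lemma triple_marked : marked_points a (classical_point K)
  (pick_if (classical_crossing K (pt a ab) (pt b ba)) ab ++
   pick_if (classical_crossing K (pt a ac) (pt c ca)) ac).
Proof.
have [aab _ _ _] := Kab; have [aac _ _ _] := Kac.
split=> [|u|u au].
- rewrite cat_uniq /pick_if; case: asboolP => _; case: asboolP => _ //=.
  by rewrite !inE orbF andbT eq_sym triple_neq.
- by rewrite mem_cat => /orP[]/mem_pick_if[_ ->].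
split=> [[y uy]|].
  have refl x : same_point x x := same_point_refl x.
  rewrite mem_cat; apply/orP.
  have [[uE yt]|[uE yt]] := triple_crossing au (classical_crossing_crossing uy);
    [left|right]; apply/mem_pick_if; split=> //; rewrite -uE.
    by case: uy => uy; [left; apply/(over_same K (refl _) yt)|
      right; apply/(over_same K yt (refl _))].
  by case: uy => uy; [left; apply/(over_same K (refl _) yt)|
    right; apply/(over_same K yt (refl _))].
by rewrite mem_cat => /orP[]/mem_pick_if[ux ->]; [exists (pt b ba)|exists (pt c ca)].
Qed.

(** Inside the disk an arc has only two crossings, so the label at one of them can be altered only
    by the other, and only if that one is classical and comes first. *)
Lemma triple_value E : labels K E ->
  let p := E (pt a (arc_begin a)) (+) `[< classical_point K (pt a (arc_begin a)) >] in
  E (pt a ab) = p (+) (`[< classical_crossing K (pt a ac) (pt c ca) >] && (ac < ab)) /\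
  E (pt a ac) = p (+) (`[< classical_crossing K (pt a ab) (pt b ba) >] && (ab < ac)).
Proof.
move=> KE p; have [aab _ _ _] := Kab; have [aac _ _ _] := Kac.
rewrite (arc_value KE triple_marked (in_oarc_value aab)).
rewrite (arc_value KE triple_marked (in_oarc_value aac)) -/p !count_cat /pick_if.
by split; congr addb; case: asboolP => _; case: asboolP => _ /=; rewrite ?ltxx //; case: (_ < _).
Qed.

End OneOfThreeArcs.

Lemma asbool_cc_sym K x y :
  `[< classical_crossing K x y >] = `[< classical_crossing K y x >].
Proof. by apply: asbool_equiv_eq; split; exact: classical_crossing_sym. Qed.

Lemma size_pick_if (P : Prop) u : size (pick_if P u) = `[< P >] :> nat.
Proof. by rewrite /pick_if; case: asboolP. Qed.

Lemma lt_swap u v : u != v -> (v < u) = ~~ (u < v).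
Proof. by move=> uv; rewrite -leNgt le_eqVlt eq_sym (negbTE uv). Qed.

(* [p], [q], [r] are the labels at the beginnings of the three arcs, [A1], [A2],
   [A3] tell which crossings are classical, and [l1], [l2], [l3] give the order
   of the crossings along the arcs. *)
Lemma third_move_parity (p q r A1 A2 A3 l1 l2 l3 : bool) :
  let k1 := p (+) (A2 && ~~ l1) != q (+) (A3 && ~~ l2) in
  let k2 := p (+) (A1 && l1) != r (+) (A3 && ~~ l3) in
  let k3 := q (+) (A1 && l2) != r (+) (A2 && l3) in
  let k1' := p (+) (A2 && l1) != q (+) (A3 && l2) in
  let k2' := p (+) (A1 && ~~ l1) != r (+) (A3 && l3) in
  let k3' := q (+) (A1 && ~~ l2) != r (+) (A2 && ~~ l3) in
  [|| [&& A1, A2 & A3], [&& A1, ~~ A2 & ~~ A3], [&& ~~ A1, A2 & ~~ A3] |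
      [&& ~~ A1, ~~ A2 & A3]] ->
  [/\ A1 -> k1 = k1', A2 -> k2 = k2', A3 -> k3 = k3' &
    let B1 := A1 && k1 in let B2 := A2 && k2 in let B3 := A3 && k3 in
    [|| [&& B1, B2 & B3], [&& B1, ~~ B2 & ~~ B3], [&& ~~ B1, B2 & ~~ B3],
      [&& ~~ B1, ~~ B2 & B3] | [&& ~~ B1, ~~ B2 & ~~ B3]]].
Proof. by case: p q r A1 A2 A3 => [] [] [] [] [] []; case: l1 l2 l3 => [] [] []. Qed.

Section ThreeArcs.
Variables (K : diagram) (phi : R * R -> R * R) (a b c : arc) (ab ba ac ca bc cb : R) (C : set point).
Let O := oarc a `|` oarc b `|` oarc c.
Hypotheses (Kdisk : disk_meets phi K C O)
  (dab : carc a `&` carc b = set0) (dac : carc a `&` carc c = set0) (dbc : carc b `&` carc c = set0)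
  (Ka : simple_arc K a) (Kb : simple_arc K b) (Kc : simple_arc K c)
  (Kab : meet_once K a b ab ba) (Kac : meet_once K a c ac ca) (Kbc : meet_once K b c bc cb).

Let aO : oarc a `<=` O. Proof. by move=> x; left; left. Qed.
Let bO : oarc b `<=` O. Proof. by move=> x; left; right. Qed.
Let cO : oarc c `<=` O. Proof. by move=> x; right. Qed.
Let Obac : O `<=` oarc b `|` oarc a `|` oarc c.
Proof. by move=> x [[]|]; [left; right|left; left|right]. Qed.
Let Ocab : O `<=` oarc c `|` oarc a `|` oarc b.
Proof. by move=> x [[]|]; [left; right|right|left; left]. Qed.
Let Oabc : O `<=` oarc a `|` oarc b `|` oarc c.
Proof. by []. Qed.

Lemma three_arcs_crossing x y : O x -> crossing K x y ->
  [\/ same_point x (pt a ab) /\ same_point y (pt b ba) \/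
      same_point x (pt b ba) /\ same_point y (pt a ab),
      same_point x (pt a ac) /\ same_point y (pt c ca) \/
      same_point x (pt c ca) /\ same_point y (pt a ac) |
      same_point x (pt b bc) /\ same_point y (pt c cb) \/
      same_point x (pt c cb) /\ same_point y (pt b bc)].
Proof.
move=> [[]|] [u du xu] xy; have {}xy := crossing_same xu (same_point_refl y) xy.
- have [[e yt]|[e yt]] := triple_crossing Kdisk aO Oabc Ka Kab Kac du xy; rewrite e in xu.
    by apply: Or31; left.
  by apply: Or32; left.
- have [[e yt]|[e yt]] := triple_crossing Kdisk bO Obac Kb (meet_once_sym Kab) Kbc du xy; rewrite e in xu.
    by apply: Or31; right.
  by apply: Or33; left.
- have [[e yt]|[e yt]] := triple_crossing Kdisk cO Ocab Kc (meet_once_sym Kac) (meet_once_sym Kbc) du xy;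
    rewrite e in xu.
    by apply: Or32; right.
  by apply: Or33; right.
Qed.

Let cc1 := classical_crossing K (pt a ab) (pt b ba).
Let cc2 := classical_crossing K (pt a ac) (pt c ca).
Let cc3 := classical_crossing K (pt b bc) (pt c cb).

Lemma three_arcs_neq : [/\ ab != ac, ba != bc & ca != cb].
Proof.
split; first exact: triple_neq dbc Kab Kac.
  exact: triple_neq dac (meet_once_sym Kab) Kbc.
exact: triple_neq dab (meet_once_sym Kac) (meet_once_sym Kbc).
Qed.

Lemma three_arcs_marked :
  [/\ marked_points a (classical_point K) (pick_if cc1 ab ++ pick_if cc2 ac),
      marked_points b (classical_point K) (pick_if cc1 ba ++ pick_if cc3 bc) &
      marked_points c (classical_point K) (pick_if cc2 ca ++ pick_if cc3 cb)].
Proof.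
split; first exact: triple_marked Kdisk aO Oabc dbc Ka Kab Kac.
  rewrite /pick_if asbool_cc_sym.
  exact: (triple_marked Kdisk bO Obac dac Kb (meet_once_sym Kab) Kbc).
rewrite /pick_if asbool_cc_sym (asbool_cc_sym K (pt b bc)).
exact: (triple_marked Kdisk cO Ocab dab Kc (meet_once_sym Kac) (meet_once_sym Kbc)).
Qed.

Lemma three_arcs_value E : labels K E ->
  let p d := E (pt d (arc_begin d)) (+) `[< classical_point K (pt d (arc_begin d)) >] in
  [/\ E (pt a ab) = p a (+) (`[< cc2 >] && ~~ (ab < ac)) /\
      E (pt a ac) = p a (+) (`[< cc1 >] && (ab < ac)),
      E (pt b ba) = p b (+) (`[< cc3 >] && ~~ (ba < bc)) /\
      E (pt b bc) = p b (+) (`[< cc1 >] && (ba < bc)) &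
      E (pt c ca) = p c (+) (`[< cc3 >] && ~~ (ca < cb)) /\
      E (pt c cb) = p c (+) (`[< cc2 >] && (ca < cb))].
Proof.
have [nab nba nca] := three_arcs_neq.
move=> KE p; rewrite -!lt_swap //; split.
- exact (triple_value Kdisk aO Oabc dbc Ka Kab Kac KE).
- rewrite /cc1 asbool_cc_sym.
  exact (triple_value Kdisk bO Obac dac Kb (meet_once_sym Kab) Kbc KE).
- rewrite /cc2 /cc3 (asbool_cc_sym K (pt a ac)) (asbool_cc_sym K (pt b bc)).
  exact (triple_value Kdisk cO Ocab dab Kc (meet_once_sym Kac) (meet_once_sym Kbc) KE).
Qed.

End ThreeArcs.

Lemma asbool_classical_crossing_virtualize K E x y : labels K E ->
  `[< classical_crossing (virtualize K E) x y >] =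
  `[< classical_crossing K x y >] && (E x != E y).
Proof.
move=> KE; apply/asboolP/andP.
  by move=> /(classical_crossing_virtualize _ _ KE)[/asboolP].
by move=> [/asboolP xy Exy]; apply/(classical_crossing_virtualize _ _ KE).
Qed.

Lemma reidemeister3_transfers X Y : reidemeister3 X Y -> exists O, transfers X Y O.
Proof.
move=> [phi [a [b [c [ab [ba [ac [ca [bc [cb [ab' [ba' [ac' [ca' /= H]]]]]]]]]]]]]].
case: H => [[phiP XY [dab [dac dbc]]] [Xd Yd] simple [mab mac mbc mab' mac']].
move=> [[lta ltb ltc] marks [oab oba] [oac oca]].
set O := oarc a `|` oarc b `|` oarc c in Xd Yd; exists O.
have [XYpos XYover XYends] := XY.
have [Xa Ya] : simple_arc X a /\ simple_arc Y a by apply: simple; left.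
have [Xb Yb] : simple_arc X b /\ simple_arc Y b by apply: simple; right; left.
have [Xc Yc] : simple_arc X c /\ simple_arc Y c by apply: simple; right; right.
have ab_disj x : oarc a x -> ~ oarc b x.
  by move=> /oarc_carc ax /oarc_carc bx; exact: disjoint_arcs dab ax bx.
have ac_disj x : oarc a x -> ~ oarc c x.
  by move=> /oarc_carc ax /oarc_carc cx; exact: disjoint_arcs dac ax cx.
have bc_disj x : oarc b x -> ~ oarc c x.
  by move=> /oarc_carc bx /oarc_carc cx; exact: disjoint_arcs dbc bx cx.
have ba_off u : in_carc b u -> ~ oarc a (pt b u).
  by move=> /pt_carc bu /oarc_carc au; exact: disjoint_arcs dab au bu.
have ca_off u : in_carc c u -> ~ oarc a (pt c u).
  by move=> /pt_carc cu /oarc_carc au; exact: disjoint_arcs dac au cu.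
(* The arcs [b] and [c] are not redrawn, so their intersection is inherited from [X]. *)
have mbc' : meet_once Y b c bc cb.
  have [bb cc [nbc ebc] bcP] := mbc; split=> //.
    by split=> //; rewrite -!XYpos //; [apply: ca_off|apply: ba_off]; exact: in_oarcW.
  move=> u v bu cv [nuv euv]; apply: bcP => //; split=> //.
  by rewrite !XYpos //; [apply: ca_off|apply: ba_off].
have [nab nba nca] := three_arcs_neq dab dac dbc mab mac mbc.
have [nab' nba' nca'] := three_arcs_neq dab dac dbc mab' mac' mbc'.
have [aX bX cX] := three_arcs_marked Xd dab dac dbc Xa Xb Xc mab mac mbc.
have [aY bY cY] := three_arcs_marked Yd dab dac dbc Ya Yb Yc mab' mac' mbc'.
have cc1 : `[< classical_crossing Y (pt a ab') (pt b ba') >] =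
    `[< classical_crossing X (pt a ab) (pt b ba) >].
  by apply: asbool_equiv_eq; rewrite /classical_crossing oab oba.
have cc2 : `[< classical_crossing Y (pt a ac') (pt c ca') >] =
    `[< classical_crossing X (pt a ac) (pt c ca) >].
  by apply: asbool_equiv_eq; rewrite /classical_crossing oac oca.
have [bbc cbc _ _] := mbc.
have cc3 : `[< classical_crossing Y (pt b bc) (pt c cb) >] =
    `[< classical_crossing X (pt b bc) (pt c cb) >].
  have bca := ba_off _ (in_oarcW bbc); have cba := ca_off _ (in_oarcW cbc).
  by apply: asbool_equiv_eq; rewrite /classical_crossing !XYover.
have off x : ~ O x -> (classical_point X x <-> classical_point Y x).
  by apply: (classical_off XY Xd Yd) => z; left; left.
have pX := @classical_point_periodic _ _ X; have pY := @classical_point_periodic _ _ Y.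
have parity d (P Q P' Q' : Prop) u v u' v' :
    marked_points d (classical_point X) (pick_if P u ++ pick_if Q v) ->
    marked_points d (classical_point Y) (pick_if P' u' ++ pick_if Q' v') ->
    `[< P' >] = `[< P >] -> `[< Q' >] = `[< Q >] ->
    same_parity d (classical_point X) (classical_point Y) /\
    same_parity d (classical_point Y) (classical_point X).
  move=> dX dY PP QQ; split; [exists (pick_if P u ++ pick_if Q v), (pick_if P' u' ++ pick_if Q' v')|
    exists (pick_if P' u' ++ pick_if Q' v'), (pick_if P u ++ pick_if Q v)]; split=> //;
    by rewrite !size_cat !size_pick_if PP QQ.
have [aXY aYX] := parity _ _ _ _ _ _ _ _ _ aX aY cc1 cc2.
have [bXY bYX] := parity _ _ _ _ _ _ _ _ _ bX bY cc1 cc3.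
have [cXY cYX] := parity _ _ _ _ _ _ _ _ _ cX cY cc2 cc3.
split=> [E XE|E' YE'|E E' XE YE' EE'].
- by have [E' YE' EE'] := relabel3 pX pY ab_disj ac_disj bc_disj aXY bXY cXY off XE; exists E'.
- have [|E XE EE'] := relabel3 pY pX ab_disj ac_disj bc_disj aYX bYX cYX _ YE'.
    by move=> x xO; apply: iff_sym; exact: off.
  by exists E => // x /EE' ->.
have aO : ~ O (pt a (arc_begin a)).
  move=> [[]|/oarc_carc]; first exact: arc_begin_oarc.
    by move=> /oarc_carc; exact: disjoint_arcs dab (arc_begin_carc a).
  exact: disjoint_arcs dac (arc_begin_carc a).
have bO : ~ O (pt b (arc_begin b)).
  move=> [[]|/oarc_carc].
  - by move=> /oarc_carc ax; exact: disjoint_arcs dab ax (arc_begin_carc b).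
  - exact: arc_begin_oarc.
  - exact: disjoint_arcs dbc (arc_begin_carc b).
have cO : ~ O (pt c (arc_begin c)).
  move=> [[]/oarc_carc x|].
  - exact: disjoint_arcs dac x (arc_begin_carc c).
  - exact: disjoint_arcs dbc x (arc_begin_carc c).
  - exact: arc_begin_oarc.
have [] := three_arcs_value Xd dab dac dbc Xa Xb Xc mab mac mbc XE.
rewrite (same_base EE' off aO) (same_base EE' off bO) (same_base EE' off cO).
have [] := three_arcs_value Yd dab dac dbc Ya Yb Yc mab' mac' mbc' YE'.
rewrite cc1 cc2 cc3.
have -> : (ab' < ac') = ~~ (ab < ac) by rewrite lta lt_swap // eq_sym.
have -> : (ba' < bc) = ~~ (ba < bc) by rewrite ltb lt_swap // eq_sym.
have -> : (ca' < cb) = ~~ (ca < cb) by rewrite ltc lt_swap // eq_sym.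
rewrite !negbK; set p := E' (pt a _) (+) _; set q := E' (pt b _) (+) _; set r := E' (pt c _) (+) _.
set A1 := `[< classical_crossing X (pt a ab) (pt b ba) >].
set A2 := `[< classical_crossing X (pt a ac) (pt c ca) >].
set A3 := `[< classical_crossing X (pt b bc) (pt c cb) >].
move=> [Yab Yac] [Yba Ybc] [Yca Ycb] [Xab Xac] [Xba Xbc] [Xca Xcb].
have A123 : [|| [&& A1, A2 & A3], [&& A1, ~~ A2 & ~~ A3], [&& ~~ A1, A2 & ~~ A3] |
    [&& ~~ A1, ~~ A2 & A3]].
  case: marks => [[m1 m2 m3 _ _]|[[m1 m2 m3]|[m1 m2 m3]|[m1 m2 m3]]]; rewrite /A1 /A2 /A3.
  - by rewrite (asboolT m1) (asboolT m2) (asboolT m3).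
  - by rewrite (asboolT m1) (asboolF m2) (asboolF m3).
  - by rewrite (asboolF m1) (asboolT m2) (asboolF m3).
  - by rewrite (asboolF m1) (asboolF m2) (asboolT m3).
(* Each order along an arc is reversed, so a classical crossing sees a change on both of its arcs or
   on neither: given that it is classical, the other two are both classical or both virtual. If all
   three are classical, [k1], [k2] and [k3] add up to 1 modulo 2, each arc contributing one flip, so
   one or three crossings survive. *)
have := @third_move_parity p q r A1 A2 A3 (ab < ac) (ba < bc) (ca < cb) A123.
rewrite /= -Xab -Xac -Xba -Xbc -Xca -Xcb -Yab -Yac -Yba -Ybc -Yca -Ycb.
move=> [k1 k2 k3 Bs].
have Oabc : O `<=` oarc a `|` oarc b `|` oarc c by [].
have aOsub : oarc a `<=` O by move=> z; left; left.
(* Off [a], the only crossing in the disk is that of [b] and [c], for which [k3] says that its fate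
   is the same in both diagrams. *)
have agree : agree_off (virtualize X E) (virtualize Y E') a.
  apply: agree_off_virtualize => // x y xa ya xy.
  have cxy : classical_crossing X x y by left.
  have [Ox|nOx] := pselect (O x); last first.
    rewrite !EE' // => Oy; apply: nOx.
    exact: disk_crossing Xd (crossing_sym (classical_crossing_crossing cxy)) Oy.
  have [aab _ _ _] := mab; have [aac _ _ _] := mac.
  have [||] := three_arcs_crossing Xd Xa Xb Xc mab mac mbc Ox (classical_crossing_crossing cxy).
  - case=> -[xs ys]; exfalso; [apply: xa|apply: ya]; [move: xs|move: ys];
      by move=> /same_point_sym/oarc_same; apply; exact: pt_oarc.
  - case=> -[xs ys]; exfalso; [apply: xa|apply: ya]; [move: xs|move: ys];
      by move=> /same_point_sym/oarc_same; apply; exact: pt_oarc.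
  case=> -[xs ys]; rewrite (labelling_same XE xs) (labelling_same XE ys)
    (labelling_same YE' xs) (labelling_same YE' ys).
    by apply: k3; apply/asboolP; left; apply/(over_same X xs ys).
  rewrite [in LHS]eq_sym [in RHS]eq_sym.
  by apply: k3; apply/asboolP; right; apply/(over_same X xs ys).
have overXY x y x' y' : (over X x y <-> over Y x' y') ->
    (over X x y -> (E x != E y) = (E' x' != E' y')) ->
    over (virtualize X E) x y <-> over (virtualize Y E') x' y'.
  move=> XYxy kxy; rewrite !over_virtualize //; split=> -[xy Exy].
    by rewrite -XYxy -kxy.
  by rewrite XYxy kxy // XYxy.
have virtual_move : third_move_marks (virtualize X E) (pt a ab) (pt b ba) (pt a ac) (pt c ca)
    (pt b bc) (pt c cb) -> basic_move (virtualize X E) (virtualize Y E').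
  move=> Vmarks; apply: Or43; exists phi, a, b, c, ab, ba, ac, ca, bc, cb, ab', ba', ac', ca'.
  split=> //; split=> //; split; apply: overXY => //.
  - by move=> xy; apply: k1; apply/asboolP; left.
  - by move=> xy; rewrite [in LHS]eq_sym [in RHS]eq_sym; apply: k1; apply/asboolP; right.
  - by move=> xy; apply: k2; apply/asboolP; left.
  - by move=> xy; rewrite [in LHS]eq_sym [in RHS]eq_sym; apply: k2; apply/asboolP; right.
have V1 := asbool_classical_crossing_virtualize (pt a ab) (pt b ba) XE.
have V2 := asbool_classical_crossing_virtualize (pt a ac) (pt c ca) XE.
have V3 := asbool_classical_crossing_virtualize (pt b bc) (pt c cb) XE.
rewrite -/A1 -/A2 -/A3 in V1 V2 V3; rewrite -V1 -V2 -V3 in Bs.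
have W1 := asbool_classical_crossing_virtualize (pt a ab') (pt b ba') YE'.
have W2 := asbool_classical_crossing_virtualize (pt a ac') (pt c ca') YE'.
rewrite cc1 -/A1 in W1; rewrite cc2 -/A2 in W2.
have {}W1 : `[< classical_crossing (virtualize Y E') (pt a ab') (pt b ba') >] =
    `[< classical_crossing (virtualize X E) (pt a ab) (pt b ba) >].
  by rewrite V1 W1; case: (A1) k1 => //= ->.
have {}W2 : `[< classical_crossing (virtualize Y E') (pt a ac') (pt c ca') >] =
    `[< classical_crossing (virtualize X E) (pt a ac) (pt c ca) >].
  by rewrite V2 W2; case: (A2) k2 => //= ->.
(* Three survivors inherit the three levels of a classical third move, a single survivor gives the
   semivirtual move, and none, possible only if one crossing was classical, gives a detour of
   [a]. *)
case/orP: Bs => [|/orP[|/orP[|/orP[|]]]] /and3P[/asboolP B1 /asboolP B2 /asboolP B3].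
- apply: virtual_move; left; split=> //.
  + case: marks => [[_ _ _ n1 _]|[[_ m _]|[m _ _]|[m _ _]]].
    * by move=> [[? _] [? _] [? _]]; apply: n1.
    * by case/classical_crossing_virtualize: B2.
    * by case/classical_crossing_virtualize: B1.
    * by case/classical_crossing_virtualize: B1.
  + case: marks => [[_ _ _ _ n2]|[[_ m _]|[m _ _]|[m _ _]]].
    * by move=> [[? _] [? _] [? _]]; apply: n2.
    * by case/classical_crossing_virtualize: B2.
    * by case/classical_crossing_virtualize: B1.
    * by case/classical_crossing_virtualize: B1.
- by apply: virtual_move; right; apply: Or31.
- by apply: virtual_move; right; apply: Or32.
- by apply: virtual_move; right; apply: Or33.
have noVX u y : in_oarc a u -> ~ classical_crossing (virtualize X E) (pt a u) y.
  move=> au uy.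
  have cuy : crossing X (pt a u) y by exact: (classical_crossing_crossing uy).
  have [[uE ys]|[uE ys]] := triple_crossing Xd aOsub Oabc Xa mab mac au cuy; rewrite uE in uy.
    by apply: B1; case: uy => uy; [left|right];
      move: uy; apply: over_periodic => //; exact: same_point_refl.
  by apply: B2; case: uy => uy; [left|right];
    move: uy; apply: over_periodic => //; exact: same_point_refl.
have noVY u y : in_oarc a u -> ~ classical_crossing (virtualize Y E') (pt a u) y.
  move=> au uy.
  have cuy : crossing Y (pt a u) y by exact: (classical_crossing_crossing uy).
  have [[uE ys]|[uE ys]] := triple_crossing Yd aOsub Oabc Ya mab' mac' au cuy; rewrite uE in uy.
    apply: B1; apply/asboolP; rewrite -W1; apply/asboolP; case: uy => uy; [left|right];
      by move: uy; apply: over_periodic => //; exact: same_point_refl.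
  apply: B2; apply/asboolP; rewrite -W2; apply/asboolP; case: uy => uy; [left|right];
    by move: uy; apply: over_periodic => //; exact: same_point_refl.
by apply: detourI agree _ _ => u au [y]; [exact: noVX|exact: noVY].
Qed.

Lemma basic_move_transfers X Y : basic_move X Y -> exists O, transfers X Y O.
Proof.
case; [exact: reidemeister1_transfers|exact: reidemeister2_transfers|
  exact: reidemeister3_transfers|exact: detour_transfers].
Qed.

End Moves.

(** * Sequences of moves *)

Section Chains.
Local Open Scope classical_set_scope.
Local Open Scope ring_scope.
Context {R : realType} {n : nat}.
Local Notation point := (@point R n).
Local Notation diagram := (diagram R n).
Implicit Types (K L M : diagram) (x y : point) (E : point -> bool).
Implicit Types (p q s : {perm 'I_n}) (c : 'I_n -> bool) (e : rel 'I_n) (k m : nat).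

(** A move together with the bijection of components induced by its two isotopies; the basic move
    itself preserves the indices. *)
Definition move_by p K L := exists X Y s s',
  [/\ isotopic_by s K X, basic_move X Y \/ basic_move Y X, isotopic_by s' Y L & p = (s * s')%g].

Lemma reidemeister_moveP K L : reidemeister_move K L <-> exists p, move_by p K L.
Proof.
split=> [[X [Y [[H [s [r KX]]] XY [H' [s' [r' YL]]]]]]|].
  by exists (s * s')%g, X, Y, s, s'; split=> //; [exists H, r|exists H', r'].
move=> [p [X [Y [s [s' [[H [r KX]] XY [H' [r' YL]] _]]]]]].
by exists X, Y; split=> //; [exists H, s, r|exists H', s', r'].
Qed.

Lemma move_by_sym p K L : move_by p K L -> move_by p^-1 L K.
Proof.
move=> [X [Y [s [s' [KX XY YL ->]]]]]; exists Y, X, s'^-1%g, s^-1%g; split.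
- exact: isotopic_by_sym.
- by case: XY; [right|left].
- exact: isotopic_by_sym.
- exact: invMg.
Qed.

Lemma reidemeister_move_sym K L : reidemeister_move K L -> reidemeister_move L K.
Proof.
by move=> /reidemeister_moveP[p /move_by_sym KL]; apply/reidemeister_moveP; exists p^-1%g.
Qed.

Lemma move_by_labels p K L E : move_by p K L -> labels K E ->
  exists2 E', labels L E' & forall c,
    move_by p (virtualize K (twist E c)) (virtualize L (twist E' (fun i => c (p^-1%g i)))).
Proof.
move=> [X [Y [s [s' [KX XY YL ->]]]]] KE.
have [EX XEX KX'] := isotopic_by_labels KX KE.
have [EY YEY XY'] : exists2 EY, labels Y EY & forall c,
    basic_move (virtualize X (twist EX c)) (virtualize Y (twist EY c)) \/
    basic_move (virtualize Y (twist EY c)) (virtualize X (twist EX c)).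
  have twist_agree A E1 E2 c : agree_outside A E1 E2 ->
      agree_outside A (twist E1 c) (twist E2 c).
    by move=> E12 x xO; rewrite /twist E12.
  case: XY => /basic_move_transfers[A [XYE YXE XYmove]].
    have [EY YEY EE] := XYE _ XEX; exists EY => // c; left.
    by apply: XYmove; [exact: labels_twist|exact: labels_twist|exact: twist_agree].
  have [EY YEY EE] := YXE _ XEX; exists EY => // c; right.
  by apply: XYmove; [exact: labels_twist|exact: labels_twist|exact: twist_agree].
have [E' LE' YL'] := isotopic_by_labels YL YEY.
exists E' => // c.
exists (virtualize X (twist EX (fun i => c (s^-1%g i)))),
  (virtualize Y (twist EY (fun i => c (s^-1%g i)))), s, s'; split=> //.
rewrite (_ : (fun i => c ((s * s')^-1 i)%g) = fun i => c (s^-1 (s'^-1 i))%g) //.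
by apply/funext => i; rewrite invMg permM.
Qed.

(* The first index counts the classical points of all diagrams but the first one;
   it decreases when a classical crossing becomes virtual. The second one is the
   induced bijection of components. *)
Inductive chain : nat -> {perm 'I_n} -> diagram -> diagram -> Prop :=
| chain_refl K : chain 0 1%g K K
| chain_step k p q K L M : move_by p K L -> chain k q L M ->
    chain (classical_count L + k) (p * q)%g K M.

Lemma chain_cat k m p q K L M : chain k p K L -> chain m q L M ->
  chain (k + m) (p * q)%g K M.
Proof.
move=> KL; elim: KL m q M => [K'|k' p' q' K' L' M' KL' LM IH] m q M MN.
  by rewrite add0n mul1g.
by rewrite -addnA -mulgA; apply: chain_step KL' _; apply: IH.
Qed.

Lemma chain_sym k p K L : chain k p K L -> exists k', chain k' p^-1%g L K.
Proof.
elim=> [K'|k' p' q' K' L' M' KL _ [m ML]].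
  by exists 0%N; rewrite invg1; exact: chain_refl.
exists (m + (classical_count K' + 0))%N; rewrite invMg; apply: chain_cat ML _.
rewrite -[p'^-1%g]mulg1.
by apply: chain_step (chain_refl _); exact: move_by_sym.
Qed.

Inductive orientable_path : diagram -> diagram -> Prop :=
| orientable_path_refl K : has_orientable_atom K -> orientable_path K K
| orientable_path_step K L M : has_orientable_atom K -> reidemeister_move K L ->
    orientable_path L M -> orientable_path K M.

Lemma orientable_path_begin K L : orientable_path K L -> has_orientable_atom K.
Proof. by case. Qed.

Lemma orientable_path_end K L : orientable_path K L -> has_orientable_atom L.
Proof. by elim. Qed.

Lemma orientable_path_cat K L M :
  orientable_path K L -> orientable_path L M -> orientable_path K M.
Proof.
elim=> // K' L' M' K'o KL _ IH /IH; exact: orientable_path_step.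
Qed.

Lemma orientable_path_sym K L : orientable_path K L -> orientable_path L K.
Proof.
elim=> [K' K'o|K' L' M' K'o KL LM ML]; first exact: orientable_path_refl.
apply: orientable_path_cat ML _; apply: (@orientable_path_step _ K').
- exact: orientable_path_begin LM.
- exact: reidemeister_move_sym.
- exact: orientable_path_refl.
Qed.

Lemma orientable_pathE K L : orientable_path K L -> exists (N : nat) (D : nat -> diagram),
  [/\ D 0%N = K, D N = L, forall i, (i <= N)%N -> has_orientable_atom (D i) &
      forall i, (i < N)%N -> reidemeister_move (D i) (D i.+1)].
Proof.
elim=> [K' K'o|K' L' M' K'o KL _ [N [D [D0 DN Do Dmove]]]].
  by exists 0%N, (fun=> K').
exists N.+1, (fun i => if i is j.+1 then D j else K'); split=> // -[|i] //.
- exact: Do.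
- by rewrite D0.
- exact: Dmove.
Qed.

(** Making crossings virtual never raises a count. If the total stays the same, no diagram after the
    first has lost a crossing; when the labels of [K] are moreover a source-sink structure, all the
    carried ones are, and the given chain is itself an orientable path. *)
Lemma chain_labels k p K M E : chain k p K M -> labels K E ->
  exists2 E', labels M E' & forall c, let c' i := c (p^-1%g i) in
    exists2 k', chain k' p (virtualize K (twist E c)) (virtualize M (twist E' c')) &
      (k' <= k)%N /\
      (k' = k -> source_sink K (twist E c) ->
        source_sink M (twist E' c') /\ orientable_path K M).
Proof.
move=> KM; elim: KM E => [K'|k' p' q K' L M' KL _ IH] E KE.
  exists E => // c c'; have -> : c' = c by apply/funext => i; rewrite /c' invg1 perm1.
  exists 0%N; first exact: chain_refl.
  split=> // _ ss; split=> //; apply: orientable_path_refl.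
  by apply/orientable_atomP; exists (twist E c) => //; exact: labels_twist.
have [E1 LE1 KLc] := move_by_labels KL KE.
have [E' ME' IHc] := IH _ LE1; exists E' => // c c'.
set c1 := fun i => c (p'^-1%g i).
have [k2 LM2 [k2k IHk]] := IHc c1.
have c'E : c' = fun i => c1 (q^-1%g i).
  by apply/funext => i; rewrite /c' /c1 invMg permM.
rewrite -c'E in LM2 IHk.
have L1 : labels L (twist E1 c1) by exact: labels_twist.
have cL := classical_count_virtualize L (twist E1 c1).
exists (classical_count (virtualize L (twist E1 c1)) + k2)%N.
  exact: chain_step (KLc c) LM2.
split=> [|kE ss]; first exact: leq_add.
have [cLE k2E] : classical_count (virtualize L (twist E1 c1)) = classical_count L /\ k2 = k'.
  have /eqP := kE; rewrite eqn_leq => /andP[_ le].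
  split; apply/eqP; rewrite eqn_leq ?cL ?k2k /=.
    by rewrite -(leq_add2r k2) (leq_trans _ le) // leq_add2l.
  by rewrite -(leq_add2l (classical_count L)) (leq_trans le) // leq_add2r.
have ssL : source_sink L (twist E1 c1).
  apply: contrapT => /(classical_count_virtualize_lt L1).
  by rewrite cLE ltnn.
have [ssM LM] := IHk k2E ssL; split=> //.
apply: orientable_path_step LM; last by apply/reidemeister_moveP; exists p'.
by apply/orientable_atomP; exists (twist E c) => //; exact: labels_twist.
Qed.

Lemma twist_false E : twist E (fun=> false) = E.
Proof. by apply/funext => x; rewrite /twist addbF. Qed.

Definition subdiagram K L := forall x y, over K x y -> over L x y.

(** Carry a source-sink structure of [K] along the chain. Either nothing is lost and the chain is
    orientable, or the virtualized chain has a smaller count and still starts at [K], whose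
    crossings are all kept. The chain to [M'] is remembered for joining two such projections
    later. *)
Lemma orientable_projection k p K M : chain k p K M -> has_orientable_atom K ->
  exists M', [/\ subdiagram M' M, orientable_path K M' & exists k', chain k' p K M'].
Proof.
elim/ltn_ind: k M => k IH M KM Ko.
have [E KE ss] := (orientable_atomP K).1 Ko.
have [E' ME' /(_ (fun=> false))[k']] := chain_labels KM KE.
rewrite /= !twist_false virtualize_id // leq_eqVlt => KM' [/predU1P[k'k|k'k] path].
  by have [_ KMo] := path k'k ss; exists M; split=> //; exists k.
have [M' [sM' KM'o KM'c]] := IH _ k'k _ KM' Ko.
exists M'; split=> // x y /sM'; by move=> /over_virtualize[].
Qed.

Definition crossings_in e K := forall x y, over K x y -> e x.1 y.1.

Definition component_pairs e := #|[pred ij : 'I_n * 'I_n | e ij.1 ij.2]|.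

(** Outer induction on the number of pairs in [e], inner induction on [k]. The relation is indexed
    by the components of [K], hence its transport by the inverse of [p] at [M]. *)
Lemma orientable_path_of_chain e k p K M :
  chain k p K M -> has_orientable_atom K -> has_orientable_atom M ->
  crossings_in e K -> crossings_in (fun i j => e (p^-1%g i) (p^-1%g j)) M ->
  orientable_path K M.
Proof.
have [m em] := ubnP (component_pairs e).
elim: m e em k p K M => // m IHm e em k p K M.
elim/ltn_ind: k K M => k IHk K M KM Ko Mo eK eM.
have [E KE ssE] := (orientable_atomP K).1 Ko.
have [E' ME' KMc] := chain_labels KM KE.
have [k' KM'] := KMc (fun=> false).
rewrite /= !twist_false virtualize_id // in KM' * => -[k'k kE].
(* If the carried labels suit [M], both ends are left intact: either the count is unchanged and the
   chain is orientable, or the virtualized chain is shorter in count and the inner induction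
   applies. *)
have [ssE'|nssE'] := pselect (source_sink M E').
  rewrite virtualize_id // in KM'.
  move: k'k; rewrite leq_eqVlt => /predU1P[/kE[]//|k'k].
  exact: IHk k'k K M KM' Ko Mo eK eM.
have [E2 ME2 ssE2] := (orientable_atomP M).1 Mo.
pose a i := E' (i, 0) (+) E2 (i, 0).
have E'a : twist E' a = E2.
  apply/funext => -[i t]; rewrite /twist /a /= (labelling_diff i 0 t ME' ME2).
  by rewrite addKb.
(* The pullback of [a] to the components of [K]. Twisting [E] by it makes the carried labels at [M]
   equal to the source-sink structure [E2], so this second virtualized chain ends at [M] itself. *)
pose c i := a (p i).
have ca : (fun i => c (p^-1%g i)) = a by apply/funext => i; rewrite /c permKV.
have [k2] := KMc c.
rewrite /= ca E'a [virtualize M E2]virtualize_id // => K'M _.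
have [k3 MK'] := chain_sym K'M.
have [M'' [M''M' KM'' [k4 KM''c]]] := orientable_projection KM' Ko.
have [K'' [K''K' MK'' [k5 MK''c]]] := orientable_projection MK' Mo.
(* A crossing between components with different values of [c] has different labels in [E], hence
   equal ones after the twist, and is lost at [K'']; symmetrically at [M''], where [E2] and [E']
   differ by [a]. *)
pose e2 i j := e i j && (c i == c j).
have e2K : crossings_in e2 K''.
  move=> x y /K''K' /(over_virtualize _ _ (labels_twist c KE))[xy].
  rewrite /e2 eK //=; have := ssE _ _ xy; rewrite /twist.
  by case: (E x) (E y) (c x.1) (c y.1) => [] [] [] [].
have e2M : crossings_in (fun i j => e2 (p^-1%g i) (p^-1%g j)) M''.
  move=> x y /M''M' /(over_virtualize _ _ ME')[xy].
  rewrite /e2 eM //= /c !permKV; have := ssE2 _ _ xy; rewrite -E'a /twist.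
  by case: (E' x) (E' y) (a x.1) (a y.1) => [] [] [] [].
have e2m : (component_pairs e2 < m)%N.
  rewrite ltnS in em; apply: leq_trans em; apply: proper_card; apply/properP; split.
    by apply/fintype.subsetP => -[i j]; rewrite !inE => /andP[].
  (* A crossing of [M] where [E'] fails but [E2] does not: its components have different values of
     [a], so its pair is in [e] but not in [e2]. *)
  have [x [y [xy E'xy]]] : exists x y, over M x y /\ E' x = E' y.
    apply: contrapT => nxy; apply: nssE' => x y xy; apply/eqP => E'xy.
    by apply: nxy; exists x, y.
  exists (p^-1%g x.1, p^-1%g y.1); first by rewrite inE /=; exact: eM.
  rewrite inE /= /e2 /c !permKV negb_and; apply/orP; right.
  have := ssE2 _ _ xy; rewrite -E'a /twist E'xy.
  by apply: contra_neq => ->.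
(* The two projections are joined by going back to [M], back along the original chain to [K], and on
   to [M'']. This may pass through nonorientable diagrams and its count is arbitrary, but its
   permutation is again [p], and the outer induction allows any count. *)
have [k6 K''M] := chain_sym MK''c; have [k7 MK] := chain_sym KM.
have K''M'' := chain_cat (chain_cat K''M MK) KM''c.
rewrite invgK mulgV mul1g in K''M''.
have K''M''o := IHm e2 e2m _ _ _ _ K''M'' (orientable_path_end MK'') (orientable_path_end KM'') e2K e2M.
apply: orientable_path_cat KM'' _.
exact: orientable_path_sym (orientable_path_cat MK'' K''M''o).
Qed.

Lemma equivalent_chain K M : equivalent K M -> exists k p, chain k p K M.
Proof.
move=> [N [D [<- <- Dmove]]]; elim: N Dmove => [|N IH] Dmove.
  by exists 0%N, 1%g; exact: chain_refl.
have [k [p DN]] := IH (fun i iN => Dmove i (leqW iN)).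
have [q Dq] := (reidemeister_moveP _ _).1 (Dmove N (leqnn _)).
exists (k + (classical_count (D N.+1) + 0))%N, (p * (q * 1))%g.
exact: chain_cat DN (chain_step Dq (chain_refl _)).
Qed.

End Chains.

Theorem theorem3p1 (R : realType) (n : nat) (K K' : diagram R n) :
  has_orientable_atom K -> has_orientable_atom K' -> equivalent K K' ->
  exists (N : nat) (D : nat -> diagram R n),
    [/\ D 0 = K, D N = K',
        forall i : nat, i <= N -> has_orientable_atom (D i) &
        forall i : nat, i < N -> reidemeister_move (D i) (D i.+1)].
Proof.
move=> Ko K'o /equivalent_chain[k [p KK']].
apply: orientable_pathE.
by apply: (orientable_path_of_chain (e := fun _ _ => true) KK' Ko K'o).
Qed.
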